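(* Let $\nu\ge0$, $c,C>0$ and $\lambda_0\ge1$. Let $S\in C^\infty([0,1]^2;\mathbb R)$, written $S(\mu,\varphi)$, and for each $\lambda\ge\lambda_0$ let $\gamma(\cdot,\lambda,\cdot)\in C^\infty(\mathbb R\times[0,1])$, written $\gamma(\mu,\lambda,\varphi)$, satisfy $$\operatorname{supp}\gamma(\cdot,\lambda,\varphi)\subset[0,1],\qquad|\partial_\mu^\alpha\gamma(\mu,\lambda,\varphi)|\le C_\alpha\,\mu^{2\nu-\alpha}(1+\lambda\varphi\mu)^{-\nu}\quad(\alpha=0,1,2,\dots),$$ $$|\partial_\mu^2S(\mu,\varphi)|\ge c,\qquad|\partial_\mu\partial_\varphi S(\mu,\varphi)|\ge C,$$ uniformly in $\mu\in[0,1]$, $\varphi\in[0,1]$ and $\lambda\ge\lambda_0$ (with constants $C_\alpha$ independent of $\mu,\varphi,\lambda$). Suppose that, for every $\varphi\in[0,1]$, $S(\cdot,\varphi)$ has a unique critical point $\mu_0(\varphi)$ which is smooth with respect to $\varphi$, and that $\mu_0(0)=0$. Define $$I(\lambda,\varphi)=\int_{\mathbb R}e^{i\lambda S(\mu,\varphi)}\gamma(\mu,\lambda,\varphi)\,d\mu.$$ Then there is a constant $C'>0$ such that $|I(\lambda,\varphi)|\le C'\lambda^{-\nu-\frac12}$ for all $\lambda\ge\lambda_0$ and $\varphi\in[0,1]$.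
   Context: ''Uniformly for $\lambda\gg1$'' in the paper is expressed here by a fixed threshold $\lambda_0$. The critical point $\mu_0(\varphi)\in[0,1]$ is with respect to $\mu$, i.e. $\partial_\mu S(\mu_0(\varphi),\varphi)=0$. The derivative bounds on $\gamma$ are understood for $\mu\in(0,1]$ wherever $\mu^{2\nu-\alpha}$ is singular at $0$. *)

(* Defs.v *)
From Stdlib Require Import Reals.
From Coquelicot Require Import Coquelicot.

Open Scope R_scope.

Definition I01 (x : R) : Prop := 0 <= x <= 1.

Definition whole (x : R) : Prop := True.

(** Differentiation relative to a set [D]: this is [is_derive] with the
    neighbourhoods of [x] traced on [D], so that it is a one-sided derivative
    at an endpoint of an interval and does not see the values of [f]
    outside [D]. *)
Definition is_derive_on {V : NormedModule R_AbsRing}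
    (D : R -> Prop) (f : R -> V) (x : R) (l : V) : Prop :=
  filterdiff f (within D (locally x)) (fun y : R => scal y l).

Definition ex_derive_on {V : NormedModule R_AbsRing}
    (D : R -> Prop) (f : R -> V) (x : R) : Prop :=
  exists l : V, is_derive_on D f x l.

(** Meaningful only where [ex_derive_on D f x] holds and [x] is an
    accumulation point of [D]. *)
Definition Derive_on {V : CompleteNormedModule R_AbsRing}
    (D : R -> Prop) (f : R -> V) (x : R) : V :=
  iota (is_derive_on D f x).

Definition smooth_on {V : CompleteNormedModule R_AbsRing}
    (D : R -> Prop) (f : R -> V) : Prop :=
  forall (k : nat) (x : R), D x -> ex_derive_on D (Nat.iter k (Derive_on D) f) x.

Definition partial1 {V : CompleteNormedModule R_AbsRing}
    (D1 : R -> Prop) (f : R -> R -> V) : R -> R -> V :=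
  fun x y => Derive_on D1 (fun t => f t y) x.

Definition partial2 {V : CompleteNormedModule R_AbsRing}
    (D2 : R -> Prop) (f : R -> R -> V) : R -> R -> V :=
  fun x y => Derive_on D2 (fun t => f x t) y.

Fixpoint Ck_on2 {V : CompleteNormedModule R_AbsRing}
    (D1 D2 : R -> Prop) (k : nat) (f : R -> R -> V) {struct k} : Prop :=
  continuous_on (fun p : R * R => D1 (fst p) /\ D2 (snd p))
                (fun p : R * R => f (fst p) (snd p)) /\
  match k with
  | O => True
  | S k' =>
      (forall x y, D1 x -> D2 y ->
         ex_derive_on D1 (fun t => f t y) x /\
         ex_derive_on D2 (fun t => f x t) y) /\
      Ck_on2 D1 D2 k' (partial1 D1 f) /\
      Ck_on2 D1 D2 k' (partial2 D2 f)
  end.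

Definition smooth_on2 {V : CompleteNormedModule R_AbsRing}
    (D1 D2 : R -> Prop) (f : R -> R -> V) : Prop :=
  forall k : nat, Ck_on2 D1 D2 k f.

Definition support (f : R -> C) : R -> Prop :=
  adherence (fun x => f x <> RtoC 0).

(** [exp (i t)] for real [t]. *)
Definition expi (t : R) : C := (cos t, sin t).

Definition osc_integral (S : R -> R -> R) (gamma : R -> R -> R -> C)
    (lambda phi : R) : C :=
  RInt_gen (V := C_R_CompleteNormedModule)
    (fun mu => Cmult (expi (lambda * S mu phi)) (gamma mu lambda phi))
    (Rbar_locally m_infty) (Rbar_locally p_infty).

(* Main.v *)
Require Import Defs.
From Stdlib Require Import Reals Lra Lia.
From Coquelicot Require Import Coquelicot.

Open Scope R_scope.

(** Write [m = mu0 phi], [s = |mu - m|], [sigma = min (mu, s)] and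
    [Y = lambda * sigma * s].  As [S_mu] vanishes at [m] and [|S_mumu| >= c],
    the mean value theorem gives [|S_mu| >= c * s].

    An integration by parts against [e^(i lambda S)] replaces the amplitude
    [f] by the derivative of [f / S_mu], divided by [lambda].  If each
    derivative of [f] costs a factor [1 / sigma], this is smaller than [f] by
    the factor [1 / Y].  The derivatives of [gamma] cost [1 / mu], those of
    [1 / S_mu] cost [1 / s], and both are at most [1 / sigma]; this is
    expressed by the symbol classes [symbol], which are stable under
    products.  After sufficiently many steps the integral over an interval
    where [Y >= 1/2] is controlled by boundary terms and by the integral of
    any majorant of [Y^(-2)]: [nonstationary_phase], [large_gain_bound].

    The size of the amplitude enters only through
    [mu^(2 nu) (1 + lambda phi mu)^(-nu) <= K lambda^(-nu) (1 + Y)^n]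
    for [n >= nu] ([amplitude_weight_bound]).  When [mu <= m/2] or
    [mu >= 2 m], one has [sigma * s >= mu^2 / 4], so that
    [lambda^nu mu^(2 nu) <= (4 Y)^nu].  When
    [m/2 <= mu <= 2 m], the second factor of the weight supplies the gain,
    because [m <= B phi]: indeed
    [c m <= |S_mu(0, phi)| = |S_mu(0, phi) - S_mu(0, 0)| <= A phi],
    as [S_mu(0, 0) = 0] and [S_muphi] is bounded
    ([critical_point_linear_bound]).

    It remains to cut [0, 1] ([left_of_crit], [right_of_crit]).  Let
    [w = lambda^(-1/2)].  On [|mu - m| <= w] one has [Y <= 1], the amplitude is
    [O(lambda^(-nu))] and the length is [O(w)].  If [m <= 2 w], then [Y] is
    bounded on all of [0, m + w], and the same estimate applies there.  If
    [m > 2 w], the same estimate applies on [0, d] with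
    [d = 1 / (lambda m) < w]; on [d, m - w], as on [m + w, 1], one has
    [Y >= 1/2] and the integral of [Y^(-2)] is [O(w)].  At the end point [1]
    the boundary terms disappear because all derivatives of [gamma] vanish
    there.

    Everything is done with real amplitudes and with the oscillating factor
    [cos (lambda S + theta)]: an integration by parts shifts [theta] by
    [- PI / 2], and the complex integral is a combination of four such real
    ones. *)

(** * Symbol classes *)

Lemma is_derive_Rmult (f g : R -> R) (x df dg : R) :
  is_derive f x df -> is_derive g x dg ->
  is_derive (fun y => f y * g y) x (df * g x + f x * dg).
Proof.
  intros Hf Hg.
  exact (is_derive_mult (K := R_AbsRing) f g x df dg Hf Hg Rmult_comm).
Qed.

(** Families of functions of [x], indexed by a parameter [t], with bounds
    uniform in [t].  The domain [D] may be any set: derivatives are two-sided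
    derivatives of functions defined on the whole line. *)
Section Symbols.

Variables (T : Type) (D : T -> R -> Prop) (sigma : T -> R -> R).
Hypothesis sigma_pos : forall t x, D t x -> 0 < sigma t x.

Definition bounded_by (W f : T -> R -> R) : Prop :=
  exists K, 0 <= K /\ forall t x, D t x -> Rabs (f t x) <= K * W t x.

(** [f] and its first [n] derivatives are controlled by the weight [W], each
    derivative costing a factor [1 / sigma].  The derivative is carried as a
    function [f'] and the weight is changed at each order, so that the algebra
    below is plain induction on [n], with no Leibniz formula for higher
    derivatives. *)
Fixpoint symbol (n : nat) (W f : T -> R -> R) : Prop :=
  bounded_by W f /\
  match n with
  | O => True
  | S n' => exists f' : T -> R -> R,
      (forall t x, D t x -> is_derive (f t) x (f' t x)) /\
      symbol n' (fun t x => W t x / sigma t x) f'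
  end.

Lemma symbol_bounded n W f : symbol n W f -> bounded_by W f.
Proof. destruct n; intros H; apply H. Qed.

Lemma symbol_pred n : forall W f, symbol (S n) W f -> symbol n W f.
Proof.
  induction n as [|n IH]; intros W f [Hb [f' [Hd Hf']]].
  - split; auto.
  - split; [exact Hb|]. exists f'; split; [exact Hd|]. now apply IH.
Qed.

Lemma symbol_weight n : forall W W' f C, 0 <= C ->
  (forall t x, D t x -> W t x <= C * W' t x) ->
  symbol n W f -> symbol n W' f.
Proof.
  assert (Hbd : forall W W' f C, 0 <= C ->
    (forall t x, D t x -> W t x <= C * W' t x) ->
    bounded_by W f -> bounded_by W' f).
  { intros W W' f C HC HW [K [HK Hb]]. exists (K * C); split.
    - now apply Rmult_le_pos.
    - intros t x Hx. eapply Rle_trans; [now apply Hb|].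
      rewrite Rmult_assoc. apply Rmult_le_compat_l; auto. }
  induction n as [|n IH]; intros W W' f C HC HW [Hb Hn];
    (split; [now apply (Hbd W W' f C)|]).
  - exact I.
  - destruct Hn as [f' [Hd Hf']]. exists f'; split; [exact Hd|].
    apply (IH _ _ _ C HC) with (2 := Hf').
    intros t x Hx. unfold Rdiv. rewrite <- Rmult_assoc.
    apply Rmult_le_compat_r; [|auto].
    left; apply Rinv_0_lt_compat; auto.
Qed.

Lemma symbol_add n : forall W f g,
  symbol n W f -> symbol n W g -> symbol n W (fun t x => f t x + g t x).
Proof.
  assert (Hbd : forall W f g, bounded_by W f -> bounded_by W g ->
    bounded_by W (fun t x => f t x + g t x)).
  { intros W f g [K [HK Hf]] [L [HL Hg]]. exists (K + L); split; [lra|].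
    intros t x Hx. eapply Rle_trans; [apply Rabs_triang|].
    rewrite Rmult_plus_distr_r. apply Rplus_le_compat; auto. }
  induction n as [|n IH]; intros W f g [Hf Hf1] [Hg Hg1];
    (split; [now apply Hbd|]).
  - exact I.
  - destruct Hf1 as [f' [Hdf Hf']]; destruct Hg1 as [g' [Hdg Hg']].
    exists (fun t x => f' t x + g' t x); split; [|now apply IH].
    intros t x Hx. apply (is_derive_plus (K := R_AbsRing) (V := R_NormedModule)); auto.
Qed.

Lemma symbol_mult n : forall W1 W2 f g,
  symbol n W1 f -> symbol n W2 g ->
  symbol n (fun t x => W1 t x * W2 t x) (fun t x => f t x * g t x).
Proof.
  assert (Hbd : forall W1 W2 f g, bounded_by W1 f -> bounded_by W2 g ->
    bounded_by (fun t x => W1 t x * W2 t x) (fun t x => f t x * g t x)).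
  { intros W1 W2 f g [K [HK Hf]] [L [HL Hg]]. exists (K * L); split.
    - now apply Rmult_le_pos.
    - intros t x Hx. rewrite Rabs_mult.
      replace (K * L * (W1 t x * W2 t x)) with (K * W1 t x * (L * W2 t x)) by ring.
      apply Rmult_le_compat; auto using Rabs_pos. }
  induction n as [|n IH]; intros W1 W2 f g Hf Hg;
    (split; [apply Hbd; eapply symbol_bounded; eassumption|]).
  - exact I.
  - pose proof (symbol_pred _ _ _ Hf) as Hf0.
    pose proof (symbol_pred _ _ _ Hg) as Hg0.
    destruct Hf as [_ [f' [Hdf Hf']]]; destruct Hg as [_ [g' [Hdg Hg']]].
    exists (fun t x => f' t x * g t x + f t x * g' t x); split.
    + intros t x Hx. apply is_derive_Rmult; auto.
    + apply symbol_add.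
      * apply (symbol_weight n) with (C := 1) (3 := IH _ _ _ _ Hf' Hg0); [lra|].
        intros t x Hx. apply Req_le. unfold Rdiv. ring.
      * apply (symbol_weight n) with (C := 1) (3 := IH _ _ _ _ Hf0 Hg'); [lra|].
        intros t x Hx. apply Req_le. unfold Rdiv. ring.
Qed.

(** How concrete symbols arise: from a sequence of functions, each the
    derivative of the preceding one, with an explicit bound at each order. *)
Lemma symbol_seq (F : nat -> T -> R -> R) (W : nat -> T -> R -> R) (N : nat) :
  (forall k t x, D t x -> is_derive (F k t) x (F (S k) t x)) ->
  (forall k, (k <= N)%nat -> bounded_by (W k) (F k)) ->
  (forall k t x, D t x -> W (S k) t x <= W k t x / sigma t x) ->
  forall n k, (k + n <= N)%nat -> symbol n (W k) (F k).
Proof.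
  intros Hd Hb HW. induction n as [|n IH]; intros k Hk;
    (split; [apply Hb; lia|]).
  - exact I.
  - exists (F (S k)); split; [intros; apply Hd; assumption|].
    apply (symbol_weight n) with (C := 1) (W := W (S k)); [lra| |apply IH; lia].
    intros t x Hx. rewrite Rmult_1_l. auto.
Qed.

End Symbols.

(** * Non-stationary phase *)

Lemma sin_cos_shift u : sin u = cos (u - PI / 2).
Proof. rewrite <- cos_shift, <- cos_neg. f_equal; ring. Qed.

(** The parameter [t] stands for the pair [(lambda, phi)], [m t] is the
    critical point and [P k t] is the [k]-th derivative of the phase. *)
Section Nonstationary.

Variables (T : Type) (lam m : T -> R) (P : nat -> T -> R -> R) (c : R).
Hypothesis lam_ge1 : forall t, 1 <= lam t.
Hypothesis m_range : forall t, 0 <= m t <= 1.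
Hypothesis c_pos : 0 < c.
Hypothesis P_derive : forall k t x, 0 < x < 1 -> is_derive (P k t) x (P (S k) t x).
Hypothesis P_bounded : forall k, exists A, forall t x, 0 < x < 1 -> Rabs (P k t x) <= A.
Hypothesis P1_lower : forall t x, 0 < x < 1 -> c * Rabs (x - m t) <= Rabs (P 1 t x).

Definition off_crit (t : T) (x : R) : Prop := 0 < x < 1 /\ x <> m t.
Definition dist (t : T) (x : R) : R := Rabs (x - m t).
(** The cost of a derivative: [1 / x] for the amplitude, [1 / dist] for
    [1 / P 1 t]. *)
Definition scale (t : T) (x : R) : R := Rmin x (dist t x).
(** One integration by parts divides the amplitude by this factor. *)
Definition gain (t : T) (x : R) : R := lam t * scale t x * dist t x.

Lemma dist_pos t x : off_crit t x -> 0 < dist t x.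
Proof. intros [_ Hx]. apply Rabs_pos_lt. lra. Qed.

Lemma scale_pos t x : off_crit t x -> 0 < scale t x.
Proof. intros Hx. apply Rmin_glb_lt; [apply Hx|now apply dist_pos]. Qed.

Lemma scale_le_dist t x : scale t x <= dist t x.
Proof. apply Rmin_r. Qed.

Lemma scale_le_1 t x : off_crit t x -> scale t x <= 1.
Proof. intros [Hx _]. unfold scale. eapply Rle_trans; [apply Rmin_l|lra]. Qed.

Lemma gain_nonneg t x : 0 <= x -> 0 <= gain t x.
Proof.
  intros Hx. unfold gain, scale, dist. pose proof (lam_ge1 t).
  pose proof (Rabs_pos (x - m t)).
  apply Rmult_le_pos; [apply Rmult_le_pos; [lra|apply Rmin_glb; lra]|lra].
Qed.

Lemma phase_symbol n k : symbol T off_crit scale n (fun _ _ => 1) (P k).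
Proof.
  apply (symbol_seq T off_crit scale scale_pos P (fun _ _ _ => 1) (k + n)).
  - intros j t x [Hx _]. now apply P_derive.
  - intros j _. destruct (P_bounded j) as [A HA]. exists (Rabs A); split.
    + apply Rabs_pos.
    + intros t x [Hx _]. rewrite Rmult_1_r.
      eapply Rle_trans; [now apply HA|apply Rle_abs].
  - intros j t x Hx. pose proof (scale_pos _ _ Hx). pose proof (scale_le_1 _ _ Hx).
    unfold Rdiv. rewrite Rmult_1_l, <- Rinv_1 at 1. apply Rinv_le_contravar; lra.
  - lia.
Qed.

Lemma P1_neq0 t x : off_crit t x -> P 1 t x <> 0.
Proof.
  intros Hx H0. pose proof (dist_pos _ _ Hx) as Hd. destruct Hx as [Hx _].
  pose proof (P1_lower t x Hx) as H. rewrite H0, Rabs_R0 in H. unfold dist in Hd.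
  pose proof (Rmult_lt_0_compat _ _ c_pos Hd). lra.
Qed.

(** By induction on the order: the derivative of [q = 1 / P 1 t] is
    [- P 2 t * q^2], and [q^2] costs [1 / dist^2 <= (1 / dist) / scale]. *)
Lemma inv_phase_symbol n :
  symbol T off_crit scale n (fun t x => / dist t x) (fun t x => / P 1 t x).
Proof.
  assert (Hb : bounded_by T off_crit (fun t x => / dist t x) (fun t x => / P 1 t x)).
  { exists (/ c); split; [left; now apply Rinv_0_lt_compat|].
    intros t x Hx. rewrite Rabs_inv, <- Rinv_mult.
    pose proof (dist_pos _ _ Hx). apply Rinv_le_contravar.
    - now apply Rmult_lt_0_compat.
    - apply P1_lower, Hx. }
  induction n as [|n IH]; (split; [exact Hb|]).
  - exact I.
  - exists (fun t x => (-1 * P 2 t x) * (/ P 1 t x * / P 1 t x)); split.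
    + intros t x Hx. pose proof (P1_neq0 _ _ Hx).
      replace (-1 * P 2 t x * (/ P 1 t x * / P 1 t x))
        with (- P 2 t x / P 1 t x ^ 2) by (field; assumption).
      apply is_derive_inv; [|assumption]. apply (P_derive 1), Hx.
    + assert (Hm1 : symbol T off_crit scale n (fun _ _ => 1) (fun _ _ => -1)).
      { apply (symbol_seq T off_crit scale scale_pos
                 (fun k _ _ => match k with O => -1 | _ => 0 end)
                 (fun _ _ _ => 1) n) with (k := O).
        - intros k t x _. destruct k; apply (is_derive_const (K := R_AbsRing) (V := R_NormedModule)).
        - intros k _. exists 1; split; [lra|]. intros t x _.
          destruct k; apply Rabs_le; lra.
        - intros k t x Hx. pose proof (scale_pos _ _ Hx). pose proof (scale_le_1 _ _ Hx).
          unfold Rdiv. rewrite Rmult_1_l, <- Rinv_1 at 1. apply Rinv_le_contravar; lra.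
        - lia. }
      pose proof (symbol_mult T off_crit scale scale_pos n _ _ _ _
         (symbol_mult T off_crit scale scale_pos n _ _ _ _ Hm1 (phase_symbol n 2))
         (symbol_mult T off_crit scale scale_pos n _ _ _ _ IH IH)) as H.
      apply (symbol_weight T off_crit scale scale_pos n) with (C := 1) (3 := H); [lra|].
      intros t x Hx. pose proof (dist_pos _ _ Hx). pose proof (scale_pos _ _ Hx).
      pose proof (scale_le_dist t x).
      unfold Rdiv. rewrite !Rmult_1_l. apply Rmult_le_compat_l.
      * left; now apply Rinv_0_lt_compat.
      * now apply Rinv_le_contravar.
Qed.

(** The amplitude produced by one integration by parts, before division by
    [lam]. *)
Lemma divide_by_phase n W f :
  symbol T off_crit scale (S n) W f ->
  bounded_by T off_crit (fun t x => W t x / dist t x) (fun t x => f t x * / P 1 t x) /\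
  exists f1 : T -> R -> R,
    (forall t x, off_crit t x -> is_derive (fun y => f t y * / P 1 t y) x (f1 t x)) /\
    symbol T off_crit scale n (fun t x => W t x / (scale t x * dist t x)) f1.
Proof.
  intros Hf.
  destruct (symbol_mult T off_crit scale scale_pos (S n) _ _ _ _ Hf (inv_phase_symbol (S n)))
    as [Hb [f1 [Hd Hf1]]].
  split; [exact Hb|]. exists f1; split; [exact Hd|].
  apply (symbol_weight T off_crit scale scale_pos n) with (C := 1) (3 := Hf1); [lra|].
  intros t x Hx. apply Req_le. unfold Rdiv. rewrite Rinv_mult. ring.
Qed.

Lemma symbol_continuous n W f t x :
  symbol T off_crit scale (S n) W f -> off_crit t x -> continuous (f t) x.
Proof.
  intros [_ [f' [Hd _]]] Hx. apply (ex_derive_continuous (K := R_AbsRing) (V := R_NormedModule)).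
  eexists. now apply Hd.
Qed.

Lemma osc_continuous theta (f : T -> R -> R) t x :
  off_crit t x -> continuous (f t) x ->
  continuous (fun y => cos (lam t * P 0 t y + theta) * f t y) x.
Proof.
  intros Hx Hf. apply (continuous_mult (K := R_AbsRing)); [|exact Hf].
  assert (Hd := P_derive 0 t x (proj1 Hx)).
  apply (ex_derive_continuous (K := R_AbsRing) (V := R_NormedModule)
    (fun y => cos (lam t * P 0 t y + theta))).
  auto_derive. exists (P 1 t x); exact Hd.
Qed.

Lemma integration_by_parts theta (f f1 : T -> R -> R) t a b :
  a <= b -> (forall x, a <= x <= b -> off_crit t x) ->
  (forall x, a <= x <= b -> continuous (f t) x) ->
  (forall x, a <= x <= b -> continuous (f1 t) x) ->
  (forall x, off_crit t x -> is_derive (fun y => f t y * / P 1 t y) x (f1 t x)) ->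
  lam t * RInt (fun x => cos (lam t * P 0 t x + theta) * f t x) a b =
    sin (lam t * P 0 t b + theta) * (f t b * / P 1 t b)
    - sin (lam t * P 0 t a + theta) * (f t a * / P 1 t a)
    - RInt (fun x => cos (lam t * P 0 t x + (theta - PI / 2)) * f1 t x) a b.
Proof.
  intros Hab Hoff Hcf Hcf1 Hd.
  set (F := fun y => sin (lam t * P 0 t y + theta) * (f t y * / P 1 t y)).
  set (u := fun x => cos (lam t * P 0 t x + theta) * f t x).
  set (v := fun x => cos (lam t * P 0 t x + (theta - PI / 2)) * f1 t x).
  assert (Hcu : forall x, a <= x <= b -> continuous u x).
  { intros x Hx. apply osc_continuous; auto. }
  assert (Hcv : forall x, a <= x <= b -> continuous v x).
  { intros x Hx. apply osc_continuous; auto. }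
  assert (Hu : ex_RInt u a b).
  { apply (ex_RInt_continuous (V := R_CompleteNormedModule)). intros z Hz.
    rewrite Rmin_left, Rmax_right in Hz by lra. auto. }
  assert (Hv : ex_RInt v a b).
  { apply (ex_RInt_continuous (V := R_CompleteNormedModule)). intros z Hz.
    rewrite Rmin_left, Rmax_right in Hz by lra. auto. }
  assert (HF : is_RInt (fun x => plus (scal (lam t) (u x)) (v x)) a b (minus (F b) (F a))).
  { apply (is_RInt_derive (V := R_CompleteNormedModule) F); intros x Hx;
      rewrite Rmin_left, Rmax_right in Hx by lra.
    - specialize (Hoff x Hx).
      assert (Hs : is_derive (fun y => sin (lam t * P 0 t y + theta)) x
                (lam t * P 1 t x * cos (lam t * P 0 t x + theta))).
      { assert (H0 := P_derive 0 t x (proj1 Hoff)).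
        auto_derive; [exists (P 1 t x); exact H0|].
        replace (Derive (fun y : R => P 0 t y) x) with (P 1 t x)
          by (symmetry; apply is_derive_unique; exact H0).
        ring. }
      pose proof (is_derive_Rmult _ _ _ _ _ Hs (Hd x Hoff)) as H.
      replace (plus (scal (lam t) (u x)) (v x)) with
        (lam t * P 1 t x * cos (lam t * P 0 t x + theta) * (f t x * / P 1 t x) +
         sin (lam t * P 0 t x + theta) * f1 t x); [exact H|].
      unfold u, v, plus, scal; simpl. unfold mult; simpl.
      rewrite sin_cos_shift.
      replace (lam t * P 0 t x + (theta - PI / 2))
        with (lam t * P 0 t x + theta - PI / 2) by ring.
      field. now apply P1_neq0.
    - apply (continuous_plus (V := R_NormedModule)); [|now apply Hcv].
      apply (continuous_scal_r (V := R_NormedModule)); now apply Hcu. }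
  assert (HF' : is_RInt (fun x => plus (scal (lam t) (u x)) (v x)) a b
                  (plus (scal (lam t) (RInt u a b)) (RInt v a b))).
  { apply (is_RInt_plus (V := R_NormedModule));
      [apply (is_RInt_scal (V := R_NormedModule))|];
      now apply (RInt_correct (V := R_CompleteNormedModule)). }
  apply (is_RInt_unique (V := R_CompleteNormedModule)) in HF.
  apply (is_RInt_unique (V := R_CompleteNormedModule)) in HF'.
  rewrite HF in HF'. unfold plus, scal, minus, opp in HF'; simpl in HF'.
  unfold mult, plus, opp in HF'; simpl in HF'. unfold F in HF'. lra.
Qed.

(** Induction on [n] through [integration_by_parts].  The new weight is
    [W / (scale * dist)], which after division by [lam] is [W / gain]; hence
    the boundary terms of every step are dominated by those of the first, and
    the majorant [h] of [W / gain ^ n] serves for all steps.  A majorant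
    is used because the weight itself need not be integrable. *)
Lemma nonstationary_phase n : forall W f,
  (forall t x, off_crit t x -> 0 <= W t x) ->
  symbol T off_crit scale (S n) W f ->
  exists K, 0 <= K /\ forall t theta a b h H,
    0 < a <= b -> b < 1 ->
    (forall x, a <= x <= b -> x <> m t) ->
    (forall x, a <= x <= b -> 1 / 2 <= gain t x) ->
    (forall x, a <= x <= b -> W t x <= h x * gain t x ^ n) ->
    is_RInt h a b H ->
    Rabs (RInt (fun x => cos (lam t * P 0 t x + theta) * f t x) a b)
      <= K * ((W t a + W t b) / sqrt (lam t) + H).
Proof.
  induction n as [|n IH]; intros W f HW Hf.
  - destruct (symbol_bounded _ _ _ _ _ _ Hf) as [K [HK Hb]].
    exists K; split; [exact HK|].
    intros t theta a b h H Ha Hb1 Hm Hgain Hh HI.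
    assert (Hoff : forall x, a <= x <= b -> off_crit t x).
    { intros x Hx. split; [lra|auto]. }
    assert (Hl : 0 < sqrt (lam t)).
    { apply sqrt_lt_R0. pose proof (lam_ge1 t). lra. }
    apply Rle_trans with (K * H).
    + apply (norm_RInt_le (V := R_NormedModule)
        (fun x => cos (lam t * P 0 t x + theta) * f t x) (fun x => scal K (h x)) a b).
      * lra.
      * intros x Hx. change (Rabs (cos (lam t * P 0 t x + theta) * f t x) <= K * h x).
        rewrite Rabs_mult. specialize (Hb t x (Hoff x Hx)). specialize (Hh x Hx).
        simpl in Hh. rewrite Rmult_1_r in Hh.
        assert (Rabs (cos (lam t * P 0 t x + theta)) <= 1)
          by (apply Rabs_le, COS_bound).
        pose proof (Rmult_le_compat_l _ _ _ HK Hh).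
        pose proof (Rabs_pos (f t x)). nra.
      * apply (RInt_correct (V := R_CompleteNormedModule)).
        apply (ex_RInt_continuous (V := R_CompleteNormedModule)). intros z Hz.
        rewrite Rmin_left, Rmax_right in Hz by lra.
        apply osc_continuous; [auto|]. eapply symbol_continuous; [exact Hf|auto].
      * now apply (is_RInt_scal (V := R_NormedModule)).
    + apply Rmult_le_compat_l; [exact HK|].
      enough (0 <= (W t a + W t b) / sqrt (lam t)) by lra.
      apply Rmult_le_pos; [|left; now apply Rinv_0_lt_compat].
      apply Rplus_le_le_0_compat; apply HW, Hoff; lra.
  - destruct (divide_by_phase _ _ _ Hf) as [[K1 [HK1 Hb1]] [f1 [Hd Hf1]]].
    destruct (IH (fun t x => W t x / (scale t x * dist t x)) f1) as [K2 [HK2 HI2]].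
    { intros t x Hx. apply Rmult_le_pos; [auto|]. left; apply Rinv_0_lt_compat.
      apply Rmult_lt_0_compat; [now apply scale_pos|now apply dist_pos]. }
    { exact Hf1. }
    exists (2 * K1 + 2 * K2); split; [lra|].
    intros t theta a b h H Ha Hb Hm Hgain Hh HI.
    assert (Hoff : forall x, a <= x <= b -> off_crit t x).
    { intros x Hx. split; [lra|auto]. }
    pose proof (lam_ge1 t) as Hl1.
    assert (Hl : 0 < sqrt (lam t)) by (apply sqrt_lt_R0; lra).
    assert (Hll : sqrt (lam t) * sqrt (lam t) = lam t) by (apply sqrt_sqrt; lra).
    pose proof (integration_by_parts theta f f1 t a b (proj2 Ha) Hoff
      (fun x Hx => symbol_continuous _ _ _ _ _ Hf (Hoff x Hx))
      (fun x Hx => symbol_continuous _ _ _ _ _ Hf1 (Hoff x Hx))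
      (Hd t)) as HIBP.
    specialize (HI2 t (theta - PI / 2) a b (fun x => lam t * h x) (lam t * H) Ha Hb Hm Hgain).
    (* The first part uses [lam * dist ^ 2 >= gain >= 1/2], which gives
       [1 / (lam * dist) <= 2 / sqrt lam]; the second says [W / gain <= 2 * W]. *)
    assert (Hend : forall x, a <= x <= b ->
       Rabs (sin (lam t * P 0 t x + theta) * (f t x * / P 1 t x))
         <= lam t * (2 * K1 * (W t x / sqrt (lam t))) /\
       W t x / (scale t x * dist t x) <= lam t * (2 * W t x)).
    { intros x Hx. specialize (Hoff x Hx). specialize (Hgain x Hx).
      pose proof (dist_pos _ _ Hoff) as Hdp. pose proof (scale_pos _ _ Hoff) as Hsp.
      pose proof (scale_le_dist t x) as Hsd. pose proof (HW _ _ Hoff) as HWx.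
      unfold gain in Hgain. split.
      - rewrite Rabs_mult. specialize (Hb1 t x Hoff).
        assert (Hs1 : Rabs (sin (lam t * P 0 t x + theta)) <= 1)
          by (apply Rabs_le, SIN_bound).
        apply Rle_trans with (K1 * (W t x / dist t x)).
        + pose proof (Rabs_pos (f t x * / P 1 t x)). nra.
        + replace (lam t * (2 * K1 * (W t x / sqrt (lam t))))
            with (K1 * (W t x * (2 * sqrt (lam t))))
            by (rewrite <- Hll at 2; field; lra).
          apply Rmult_le_compat_l; [exact HK1|].
          apply Rmult_le_compat_l; [exact HWx|].
          rewrite <- (Rinv_inv (2 * sqrt (lam t))).
          apply Rinv_le_contravar; [apply Rinv_0_lt_compat; lra|].
          apply Rmult_le_reg_l with (2 * sqrt (lam t)); [lra|].
          rewrite Rinv_r by lra.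
          assert (lam t * scale t x * dist t x <= lam t * (dist t x * dist t x)).
          { rewrite Rmult_assoc. apply Rmult_le_compat_l; [lra|].
            apply Rmult_le_compat_r; lra. }
          assert (1 / 2 <= (sqrt (lam t) * dist t x) * (sqrt (lam t) * dist t x)).
          { replace ((sqrt (lam t) * dist t x) * (sqrt (lam t) * dist t x))
              with ((sqrt (lam t) * sqrt (lam t)) * (dist t x * dist t x)) by ring.
            rewrite Hll. lra. }
          assert (0 < sqrt (lam t) * dist t x) by now apply Rmult_lt_0_compat.
          nra.
      - assert (Hp : 0 < scale t x * dist t x) by now apply Rmult_lt_0_compat.
        apply Rmult_le_reg_r with (scale t x * dist t x); [exact Hp|].
        unfold Rdiv. rewrite Rmult_assoc, Rinv_l by lra.
        replace (lam t * (2 * W t x) * (scale t x * dist t x))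
          with (W t x * (2 * (lam t * scale t x * dist t x))) by ring.
        apply Rmult_le_compat_l; [exact HWx|lra]. }
    lapply HI2; [clear HI2; intros HI3|].
    2:{ intros x Hx. specialize (Hh x Hx). specialize (Hoff x Hx).
        pose proof (dist_pos _ _ Hoff) as Hdp. pose proof (scale_pos _ _ Hoff) as Hsp.
        assert (Hp : 0 < scale t x * dist t x) by now apply Rmult_lt_0_compat.
        apply Rmult_le_reg_r with (scale t x * dist t x); [exact Hp|].
        unfold Rdiv. rewrite Rmult_assoc, Rinv_l, Rmult_1_r by lra.
        eapply Rle_trans; [exact Hh|]. apply Req_le. simpl. unfold gain. ring. }
    lapply HI3; [clear HI3; intros HI3|].
    2:{ now apply (is_RInt_scal (V := R_NormedModule)). }
    destruct (Hend a) as [Ha1 Ha2]; [lra|].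
    destruct (Hend b) as [Hb1' Hb2]; [lra|].
    assert (HWa : 0 <= W t a) by (apply HW, Hoff; lra).
    assert (HWb : 0 <= W t b) by (apply HW, Hoff; lra).
    set (I0 := RInt (fun x => cos (lam t * P 0 t x + theta) * f t x) a b) in *.
    set (I1 := RInt (fun x => cos (lam t * P 0 t x + (theta - PI / 2)) * f1 t x) a b) in *.
    apply Rmult_le_reg_l with (lam t); [lra|].
    rewrite <- (Rabs_pos_eq (lam t)) at 1 by lra.
    rewrite <- Rabs_mult, HIBP.
    set (X := sin (lam t * P 0 t a + theta) * (f t a * / P 1 t a)) in *.
    set (Z := sin (lam t * P 0 t b + theta) * (f t b * / P 1 t b)) in *.
    assert (Htri : Rabs (Z - X - I1) <= Rabs Z + Rabs X + Rabs I1).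
    { unfold Rabs; repeat destruct Rcase_abs; lra. }
    assert (HH : 0 <= H).
    { rewrite <- (is_RInt_unique (V := R_CompleteNormedModule) _ _ _ _ HI).
      apply RInt_ge_0; [lra|eexists; exact HI|]. intros x Hx.
      assert (Hx' : a <= x <= b) by lra. specialize (Hh x Hx').
      pose proof (HW _ _ (Hoff x Hx')) as HWx.
      assert (Hg : 0 < gain t x ^ S n) by (apply pow_lt; specialize (Hgain x Hx'); lra).
      apply Rmult_le_reg_r with (gain t x ^ S n); lra. }
    set (E := (W t a + W t b) / sqrt (lam t)).
    assert (HE1 : 0 <= E).
    { apply Rmult_le_pos; [lra|left; now apply Rinv_0_lt_compat]. }
    assert (HI4 : Rabs I1 <= K2 * (lam t * (2 * E) + lam t * H)).
    { eapply Rle_trans; [exact HI3|]. apply Rmult_le_compat_l; [exact HK2|].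
      apply Rplus_le_compat_r. unfold E, Rdiv.
      replace (lam t * (2 * ((W t a + W t b) * / sqrt (lam t))))
        with ((lam t * (2 * W t a) + lam t * (2 * W t b)) * / sqrt (lam t)) by ring.
      apply Rmult_le_compat_r; [left; now apply Rinv_0_lt_compat|]. unfold Rdiv in *. lra. }
    assert (HE2 : Rabs Z + Rabs X <= lam t * (2 * K1 * E)).
    { replace (lam t * (2 * K1 * E)) with
        (lam t * (2 * K1 * (W t b / sqrt (lam t))) + lam t * (2 * K1 * (W t a / sqrt (lam t))))
        by (unfold E; field; lra). lra. }
    assert (HKE : 0 <= K1 * H) by now apply Rmult_le_pos.
    assert (HKH : 0 <= K2 * H) by now apply Rmult_le_pos.
    replace (lam t * ((2 * K1 + 2 * K2) * (E + H))) with
      (lam t * (2 * K1 * E) + K2 * (lam t * (2 * E) + lam t * H)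
        + lam t * (2 * (K1 * H) + K2 * H)) by ring.
    assert (0 <= lam t * (2 * (K1 * H) + K2 * H)) by (apply Rmult_le_pos; lra).
    lra.
Qed.


(** * Real amplitudes *)

(** [G k t] is the [k]-th derivative of the amplitude and [M] stands for
    [lambda ^ (- nu)]. *)
Variables (G : nat -> T -> R -> R) (M : T -> R) (n0 : nat).
Hypothesis P0_continuous : forall t x, continuous (P 0 t) x.
Hypothesis G_derive : forall k t x, is_derive (G k t) x (G (S k) t x).
Hypothesis G_end : forall k t, G k t 1 = 0.
Hypothesis M_pos : forall t, 0 < M t.
Hypothesis G_bound : forall k, exists C, forall t x, 0 < x < 1 ->
  Rabs (G k t x) * x ^ k <= C * (M t * (1 + gain t x) ^ n0).

(** Used as the weight of the amplitude in place of its upper bound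
    [M * (1 + gain) ^ n0]: it is continuous and vanishes at [1], so the
    boundary terms of the integrations by parts become negligible there.
    The bound itself does not tend to [0] at [1]. *)
Definition jet_size (N : nat) (t : T) (x : R) : R :=
  sum_f_R0 (fun j => Rabs (G j t x) * x ^ j) N.

Lemma jet_size_ge N t x k : 0 <= x -> (k <= N)%nat ->
  Rabs (G k t x) * x ^ k <= jet_size N t x.
Proof.
  intros Hx Hk. unfold jet_size.
  assert (Hp : forall j, 0 <= Rabs (G j t x) * x ^ j).
  { intros j. apply Rmult_le_pos; [apply Rabs_pos|now apply pow_le]. }
  induction N as [|N IH].
  - replace k with O by lia. apply Rle_refl.
  - rewrite tech5. destruct (Nat.eq_dec k (S N)) as [->|Hne].
    + assert (0 <= sum_f_R0 (fun j => Rabs (G j t x) * x ^ j) N) by now apply cond_pos_sum.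
      lra.
    + specialize (Hp (S N)). assert (k <= N)%nat by lia. specialize (IH H). lra.
Qed.

Lemma jet_size_pos N t x : 0 <= x -> 0 <= jet_size N t x.
Proof.
  intros Hx. eapply Rle_trans; [|apply (jet_size_ge N t x 0 Hx); lia].
  apply Rmult_le_pos; [apply Rabs_pos|now apply pow_le].
Qed.

Lemma jet_size_bound N : exists C, 0 <= C /\ forall t x, 0 < x < 1 ->
  jet_size N t x <= C * (M t * (1 + gain t x) ^ n0).
Proof.
  assert (Hp : forall t x, 0 < x < 1 -> 0 <= M t * (1 + gain t x) ^ n0).
  { intros t x Hx. apply Rmult_le_pos; [left; apply M_pos|]. apply pow_le.
    assert (0 <= gain t x) by (apply gain_nonneg; lra). lra. }
  induction N as [|N [C1 [HC1 H1]]].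
  - destruct (G_bound 0) as [C HC]. exists (Rabs C); split; [apply Rabs_pos|].
    intros t x Hx. eapply Rle_trans; [now apply HC|].
    apply Rmult_le_compat_r; [now apply Hp|apply Rle_abs].
  - destruct (G_bound (S N)) as [C HC]. exists (C1 + Rabs C); split.
    + pose proof (Rabs_pos C). lra.
    + intros t x Hx. unfold jet_size. rewrite tech5.
      specialize (H1 t x Hx). specialize (HC t x Hx). specialize (Hp t x Hx).
      pose proof (Rmult_le_compat_r _ _ _ Hp (Rle_abs C)).
      unfold jet_size in H1. lra.
Qed.

Lemma jet_size_continuous N t x : continuous (jet_size N t) x.
Proof.
  assert (Hc : forall k, continuous (fun y => Rabs (G k t y) * y ^ k) x).
  { intros k. apply (continuous_mult (K := R_AbsRing)).
    - apply (continuous_comp (G k t) Rabs).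
      + apply (ex_derive_continuous (K := R_AbsRing) (V := R_NormedModule)).
        eexists; apply G_derive.
      + apply continuous_Rabs.
    - apply (ex_derive_continuous (K := R_AbsRing) (V := R_NormedModule) (fun y => y ^ k)).
      auto_derive. exact I. }
  induction N as [|N IH].
  - apply (Hc O).
  - apply (continuous_ext (fun y => jet_size N t y + Rabs (G (S N) t y) * y ^ S N)).
    + intros y. reflexivity.
    + apply (continuous_plus (V := R_NormedModule)); [exact IH|apply Hc].
Qed.

Lemma jet_size_end N t : jet_size N t 1 = 0.
Proof.
  induction N as [|N IH]; unfold jet_size in *.
  - simpl. rewrite G_end, Rabs_R0. ring.
  - rewrite tech5, IH, G_end, Rabs_R0. ring.
Qed.

Lemma jet_size_small_near_end N t :
  exists d, 0 < d /\ forall x, 1 - d < x < 1 -> jet_size N t x <= M t.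
Proof.
  pose proof (proj1 (filterlim_locally _ _) (jet_size_continuous N t 1)
                (mkposreal _ (M_pos t))) as [d Hd].
  exists d; split; [apply cond_pos|]. intros x Hx.
  assert (Hb : ball 1 d x).
  { change (Rabs (x - 1) < d). apply Rabs_def1; lra. }
  specialize (Hd x Hb). change (Rabs (jet_size N t x - jet_size N t 1) < M t) in Hd.
  rewrite jet_size_end in Hd. apply Rabs_def2 in Hd. lra.
Qed.

Lemma amplitude_symbol N : symbol T off_crit scale N (jet_size N) (G 0).
Proof.
  apply (symbol_weight T off_crit scale scale_pos N) with (C := 1)
    (W := fun t x => jet_size N t x / scale t x ^ 0); [lra| |].
  { intros t x Hx. simpl. lra. }
  apply (symbol_seq T off_crit scale scale_pos G
           (fun k t x => jet_size N t x / scale t x ^ k) N).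
  - intros k t x _. apply G_derive.
  - intros k Hk. exists 1; split; [lra|]. intros t x Hx. rewrite Rmult_1_l.
    pose proof (scale_pos _ _ Hx) as Hs.
    assert (Hsk : 0 < scale t x ^ k) by now apply pow_lt.
    apply Rmult_le_reg_r with (scale t x ^ k); [exact Hsk|].
    unfold Rdiv. rewrite Rmult_assoc, Rinv_l, Rmult_1_r by lra.
    eapply Rle_trans; [|apply (jet_size_ge N t x k); [destruct Hx; lra|exact Hk]].
    apply Rmult_le_compat_l; [apply Rabs_pos|].
    apply pow_incr. split; [lra|apply Rmin_l].
  - intros k t x Hx. pose proof (scale_pos _ _ Hx). apply Req_le. simpl. field.
    split; [apply pow_nonzero|]; lra.
  - lia.
Qed.

Definition osc (t : T) (theta x : R) : R := cos (lam t * P 0 t x + theta) * G 0 t x.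

Lemma ex_RInt_osc t theta a b : ex_RInt (osc t theta) a b.
Proof.
  apply (ex_RInt_continuous (V := R_CompleteNormedModule)). intros x _.
  unfold osc. apply (continuous_mult (K := R_AbsRing)).
  - apply (continuous_comp (fun y => lam t * P 0 t y + theta) cos).
    + apply (continuous_plus (V := R_NormedModule)); [|apply continuous_const].
      apply (continuous_scal_r (V := R_NormedModule)), P0_continuous.
    + apply (ex_derive_continuous (K := R_AbsRing) (V := R_NormedModule)).
      eexists; apply is_derive_cos.
  - apply (ex_derive_continuous (K := R_AbsRing) (V := R_NormedModule)).
    eexists; apply G_derive.
Qed.

Lemma RInt_osc_Chasles t theta a b d :
  RInt (osc t theta) a d = RInt (osc t theta) a b + RInt (osc t theta) b d.
Proof.
  symmetry. apply (RInt_Chasles (V := R_CompleteNormedModule)); apply ex_RInt_osc.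
Qed.

Lemma trivial_bound t theta a b B :
  a <= b -> (forall x, a < x < b -> Rabs (G 0 t x) <= B) ->
  Rabs (RInt (osc t theta) a b) <= B * (b - a).
Proof.
  intros Hab HB.
  assert (Ho : forall x, a < x < b -> Rabs (osc t theta x) <= B).
  { intros x Hx. unfold osc. rewrite Rabs_mult.
    assert (Rabs (cos (lam t * P 0 t x + theta)) <= 1) by (apply Rabs_le, COS_bound).
    specialize (HB x Hx). pose proof (Rabs_pos (G 0 t x)). nra. }
  assert (Hc : forall K : R, ex_RInt (fun _ => K) a b) by (intros; apply ex_RInt_const).
  assert (HcI : forall K : R, RInt (fun _ => K) a b = K * (b - a)).
  { intros K. rewrite RInt_const. unfold scal; simpl; unfold mult; simpl. ring. }
  apply Rabs_le. split.
  - replace (- (B * (b - a))) with (- B * (b - a)) by ring. rewrite <- (HcI (- B)).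
    apply RInt_le; auto using ex_RInt_osc. intros x Hx.
    specialize (Ho x Hx). apply Rabs_le_between in Ho. lra.
  - rewrite <- (HcI B).
    apply RInt_le; auto using ex_RInt_osc. intros x Hx.
    specialize (Ho x Hx). apply Rabs_le_between in Ho. lra.
Qed.

(** The length [lambda ^ (- 1/2)] of the stationary region. *)
Definition width (t : T) : R := / sqrt (lam t).

Lemma width_pos t : 0 < width t.
Proof. apply Rinv_0_lt_compat, sqrt_lt_R0. pose proof (lam_ge1 t). lra. Qed.

Lemma lam_width t : lam t = / (width t * width t).
Proof.
  unfold width. pose proof (lam_ge1 t).
  rewrite <- Rinv_mult, Rinv_inv, sqrt_sqrt; lra.
Qed.

Lemma lam_width_sqr t : lam t * (width t * width t) = 1.
Proof.
  rewrite lam_width. pose proof (width_pos t). apply Rinv_l. nra.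
Qed.

(** Where the gain is bounded, the amplitude is [O(M)] and no cancellation is
    needed on an interval of length [O(width)]. *)
Lemma small_gain_bound : exists K, 0 <= K /\ forall t theta a b,
  0 <= a <= b -> b <= 1 -> b - a <= 4 * width t ->
  (forall x, a < x < b -> gain t x <= 4) ->
  Rabs (RInt (osc t theta) a b) <= K * (M t * width t).
Proof.
  destruct (jet_size_bound 0) as [C [HC Hj]].
  exists (C * 5 ^ n0 * 4); split.
  { repeat apply Rmult_le_pos; try lra. apply pow_le; lra. }
  intros t theta a b Ha Hb Hlen Hg.
  assert (HM := M_pos t). assert (H5 : 0 < 5 ^ n0) by (apply pow_lt; lra).
  apply Rle_trans with ((C * (M t * 5 ^ n0)) * (b - a)).
  - apply trivial_bound; [lra|]. intros x Hx.
    assert (Hx0 : 0 < x < 1) by lra.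
    pose proof (jet_size_ge 0 t x 0 (Rlt_le _ _ (proj1 Hx0)) (Nat.le_refl _)) as H1.
    specialize (Hj t x Hx0). specialize (Hg x Hx). simpl in H1. rewrite Rmult_1_r in H1.
    eapply Rle_trans; [exact H1|]. eapply Rle_trans; [exact Hj|].
    apply Rmult_le_compat_l; [exact HC|]. apply Rmult_le_compat_l; [lra|].
    apply pow_incr. split; [|lra].
    assert (0 <= gain t x) by (apply gain_nonneg; lra). lra.
  - replace (C * 5 ^ n0 * 4 * (M t * width t))
      with (C * (M t * 5 ^ n0) * (4 * width t)) by ring.
    apply Rmult_le_compat_l; [|lra].
    repeat apply Rmult_le_pos; lra.
Qed.

(** With [n0 + 2] integrations by parts, [(1 + gain) ^ n0] is absorbed and the
    factor [gain ^ (-2)] is left over, which [h] dominates. *)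
Lemma large_gain_bound : exists K, 0 <= K /\ forall t theta a b h H,
  0 < a <= b -> b < 1 ->
  (forall x, a <= x <= b -> x <> m t) ->
  (forall x, a <= x <= b -> 1 / 2 <= gain t x) ->
  (forall x, a <= x <= b -> 1 <= h x * gain t x ^ 2) ->
  is_RInt h a b H -> H <= 4 * width t ->
  gain t a <= 4 -> (gain t b <= 4 \/ jet_size (S (n0 + 2)) t b <= M t) ->
  Rabs (RInt (osc t theta) a b) <= K * (M t * width t).
Proof.
  set (N := S (n0 + 2)).
  destruct (jet_size_bound N) as [C [HC Hj]].
  destruct (nonstationary_phase (n0 + 2) (jet_size N) (G 0)) as [K [HK HN]].
  { intros t x [Hx _]. apply jet_size_pos; lra. }
  { apply amplitude_symbol. }
  assert (H5 : 0 < 5 ^ n0) by (apply pow_lt; lra).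
  assert (H3 : 0 < 3 ^ n0) by (apply pow_lt; lra).
  exists (K * (2 * (C * 5 ^ n0 + 1) + C * 3 ^ n0 * 4)); split.
  { apply Rmult_le_pos; [lra|]. pose proof (Rmult_le_pos _ _ HC (Rlt_le _ _ H5)).
    pose proof (Rmult_le_pos _ _ HC (Rlt_le _ _ H3)). lra. }
  intros t theta a b h H Ha Hb Hm Hg Hh HI HH Hga Hgb.
  assert (HM := M_pos t). assert (Hw := width_pos t).
  specialize (HN t theta a b (fun x => scal (C * M t * 3 ^ n0) (h x))
     (scal (C * M t * 3 ^ n0) H) Ha Hb Hm Hg).
  assert (HVs : forall x, a <= x <= b -> gain t x <= 4 -> jet_size N t x <= C * 5 ^ n0 * M t).
  { intros x Hx Hgx. assert (Hx0 : 0 < x < 1) by lra. specialize (Hg x Hx).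
    eapply Rle_trans; [now apply Hj|].
    replace (C * 5 ^ n0 * M t) with (C * (M t * 5 ^ n0)) by ring.
    apply Rmult_le_compat_l; [exact HC|]. apply Rmult_le_compat_l; [lra|].
    apply pow_incr. lra. }
  lapply HN; [clear HN; intros HN|].
  2:{ intros x Hx. assert (Hx0 : 0 < x < 1) by lra. specialize (Hg x Hx).
      specialize (Hh x Hx).
      eapply Rle_trans; [now apply Hj|].
      change (scal (C * M t * 3 ^ n0) (h x)) with (C * M t * 3 ^ n0 * h x).
      rewrite Nat.add_comm, pow_add.
      apply Rle_trans with (C * (M t * (3 * gain t x) ^ n0)).
      - apply Rmult_le_compat_l; [exact HC|]. apply Rmult_le_compat_l; [lra|].
        apply pow_incr. lra.
      - rewrite Rpow_mult_distr.
        replace (C * M t * 3 ^ n0 * h x * (gain t x ^ 2 * gain t x ^ n0)) with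
          (C * (M t * (3 ^ n0 * gain t x ^ n0)) * (h x * gain t x ^ 2)) by ring.
        rewrite <- (Rmult_1_r (C * _)) at 1.
        apply Rmult_le_compat_l; [|exact Hh].
        assert (0 <= gain t x ^ n0) by (apply pow_le; lra).
        repeat apply Rmult_le_pos; lra. }
  lapply HN; [clear HN; intros HN|].
  2:{ now apply (is_RInt_scal (V := R_NormedModule)). }
  eapply Rle_trans; [exact HN|].
  rewrite (Rmult_assoc K). apply Rmult_le_compat_l; [exact HK|].
  rewrite Rmult_plus_distr_r. apply Rplus_le_compat.
  - unfold Rdiv. fold (width t).
    replace (2 * (C * 5 ^ n0 + 1) * (M t * width t)) with
      (((C * 5 ^ n0 * M t + M t) + (C * 5 ^ n0 * M t + M t)) * width t) by ring.
    apply Rmult_le_compat_r; [lra|].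
    assert (0 <= C * 5 ^ n0 * M t)
      by (apply Rmult_le_pos; [apply Rmult_le_pos|]; lra).
    assert (jet_size N t a <= C * 5 ^ n0 * M t) by (apply HVs; [lra|assumption]).
    assert (jet_size N t b <= C * 5 ^ n0 * M t + M t).
    { destruct Hgb as [Hgb|Hgb]; [|lra].
      assert (jet_size N t b <= C * 5 ^ n0 * M t) by (apply HVs; [lra|assumption]). lra. }
    lra.
  - change (scal (C * M t * 3 ^ n0) H) with (C * M t * 3 ^ n0 * H).
    replace (C * 3 ^ n0 * 4 * (M t * width t))
      with (C * M t * 3 ^ n0 * (4 * width t)) by ring.
    apply Rmult_le_compat_l; [|exact HH].
    apply Rmult_le_pos; [apply Rmult_le_pos|]; lra.
Qed.

(** Here [gain = lam * (x - m) ^ 2 >= 1], and [1 / gain] serves as the majorant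
    of [1 / gain ^ 2].  The integration by parts stops at a point [b < 1]
    where the amplitude is already below [M], within [width] of [1]. *)
Lemma right_of_crit : exists K, 0 <= K /\ forall t theta,
  m t + width t < 1 ->
  Rabs (RInt (osc t theta) (m t + width t) 1) <= K * (M t * width t).
Proof.
  destruct large_gain_bound as [K [HK HL]].
  exists (K + 1); split; [lra|]. intros t theta Hlt.
  assert (HM := M_pos t). assert (Hw := width_pos t). assert (Hmt := m_range t).
  destruct (jet_size_small_near_end (S (n0 + 2)) t) as [d [Hd Hend]].
  set (b := Rmax (m t + width t) (1 - Rmin (d / 2) (width t))).
  assert (Hmin : 0 < Rmin (d / 2) (width t)) by (apply Rmin_glb_lt; lra).
  assert (Hmd := Rmin_l (d / 2) (width t)). assert (Hmw := Rmin_r (d / 2) (width t)).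
  assert (Hb : m t + width t <= b < 1).
  { split; [apply Rmax_l|]. apply Rmax_lub_lt; lra. }
  assert (Hb' : 1 - Rmin (d / 2) (width t) <= b) by apply Rmax_r.
  assert (Hgain : forall x, m t + width t <= x -> gain t x = lam t * (x - m t) ^ 2).
  { intros x Hx. unfold gain, scale, dist. rewrite Rabs_pos_eq by lra.
    rewrite Rmin_right by lra. ring. }
  assert (Hg1 : forall x, m t + width t <= x -> 1 <= gain t x).
  { intros x Hx. rewrite (Hgain x Hx). rewrite <- (lam_width_sqr t) at 1.
    pose proof (lam_ge1 t). apply Rmult_le_compat_l; [lra|]. nra. }
  rewrite (RInt_osc_Chasles t theta _ b).
  eapply Rle_trans; [apply Rabs_triang|]. rewrite Rmult_plus_distr_r, Rmult_1_l.
  apply Rplus_le_compat.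
  - assert (Hlw := lam_width_sqr t). pose proof (lam_ge1 t).
    apply HL with (h := fun x => / (lam t * (x - m t) ^ 2))
      (H := minus (- / (lam t * (b - m t))) (- / (lam t * (m t + width t - m t)))).
    + lra.
    + lra.
    + intros x Hx. lra.
    + intros x Hx. specialize (Hg1 x (proj1 Hx)). lra.
    + intros x Hx. specialize (Hg1 x (proj1 Hx)). rewrite <- (Hgain x (proj1 Hx)).
      replace (/ gain t x * gain t x ^ 2) with (gain t x) by (field; lra). exact Hg1.
    + apply (is_RInt_derive (V := R_CompleteNormedModule) (fun x => - / (lam t * (x - m t))));
        intros x Hx; rewrite Rmin_left, Rmax_right in Hx by lra.
      * auto_derive; [apply Rmult_integral_contrapositive_currified; lra|].
        field. lra.
      * apply (ex_derive_continuous (K := R_AbsRing) (V := R_NormedModule)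
                 (fun x => / (lam t * (x - m t) ^ 2))).
        auto_derive. apply Rmult_integral_contrapositive_currified; [lra|].
        apply Rmult_integral_contrapositive_currified; lra.
    + unfold minus, plus, opp; simpl.
      assert (0 < / (lam t * (b - m t))).
      { apply Rinv_0_lt_compat. apply Rmult_lt_0_compat; lra. }
      replace (m t + width t - m t) with (width t) by ring.
      replace (/ (lam t * width t)) with (width t) by (rewrite lam_width; field; lra).
      lra.
    + rewrite Hgain by lra.
      replace (lam t * (m t + width t - m t) ^ 2) with 1; [lra|].
      rewrite <- Hlw at 1. ring.
    + right; apply Hend; lra.
  - eapply Rle_trans; [apply (trivial_bound t theta b 1 (M t)); [lra|]|].
    + intros x Hx. eapply Rle_trans; [|apply (Hend x); lra].
      eapply Rle_trans; [|apply (jet_size_ge _ t x 0); [lra|lia]].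
      simpl. lra.
    + apply Rmult_le_compat_l; lra.
Qed.

(** When [m > 2 * width], the interval is cut at [d = 1 / (lam * m)], where the
    gain becomes of order [1], and at [m - width].  In between,
    [gain >= lam * m * x / 2] for [x <= m / 2] and [gain = lam * (m - x) ^ 2]
    for [x >= m / 2]; the majorant [h] of [1 / gain ^ 2] is the sum of what
    these two bounds give. *)
Lemma left_of_crit : exists K, 0 <= K /\ forall t theta,
  Rabs (RInt (osc t theta) 0 (Rmin 1 (m t + width t))) <= K * (M t * width t).
Proof.
  destruct large_gain_bound as [K [HK HL]].
  destruct small_gain_bound as [K' [HK' HS]].
  exists (K + 2 * K'); split; [lra|]. intros t theta.
  assert (HM := M_pos t). assert (Hw := width_pos t). assert (Hmt := m_range t).
  assert (HMw : 0 < M t * width t) by now apply Rmult_lt_0_compat.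
  set (r := Rmin 1 (m t + width t)).
  assert (Hr1 : r <= 1) by apply Rmin_l.
  assert (Hr2 : r <= m t + width t) by apply Rmin_r.
  assert (Hr3 : m t <= r) by (apply Rmin_glb; lra).
  assert (Hl := lam_ge1 t). assert (Hlw := lam_width_sqr t).
  assert (Hnear : forall x q, 0 <= q -> Rabs (x - m t) <= q * width t -> gain t x <= q * q).
  { intros x q Hq Hx. unfold gain.
    pose proof (scale_le_dist t x) as H1. pose proof (Rabs_pos (x - m t)) as H2.
    fold (dist t x) in *.
    replace (q * q) with (lam t * ((q * width t) * (q * width t)))
      by (rewrite <- (Rmult_1_r (q * q)), <- Hlw; ring).
    rewrite Rmult_assoc. apply Rmult_le_compat_l; [lra|]. nra. }
  destruct (Rle_or_lt (m t) (2 * width t)) as [Hm|Hm].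
  - apply Rle_trans with (K' * (M t * width t)).
    + apply HS; try lra.
      intros x Hx. replace 4 with (2 * 2) by ring. apply Hnear; [lra|].
      apply Rabs_le. lra.
    + apply Rmult_le_compat_r; lra.
  - set (d := / (lam t * m t)).
    assert (Hm0 : 0 < m t) by lra.
    assert (Hlm : 0 < lam t * m t) by (apply Rmult_lt_0_compat; lra).
    assert (Hd0 : 0 < d) by now apply Rinv_0_lt_compat.
    assert (Hdm : lam t * d * m t = 1) by (unfold d; field; split; lra).
    assert (Hdw : 2 * d < width t).
    { apply Rmult_lt_reg_l with (lam t * m t); [exact Hlm|].
      replace (lam t * m t * (2 * d)) with (2 * (lam t * d * m t)) by ring.
      rewrite Hdm, Rmult_1_r, <- (Rmult_1_r 2), <- Hlw at 1.
      replace (2 * (lam t * (width t * width t)))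
        with ((lam t * width t) * (2 * width t)) by ring.
      replace (lam t * m t * width t) with ((lam t * width t) * m t) by ring.
      apply Rmult_lt_compat_l; [|exact Hm]. apply Rmult_lt_0_compat; lra. }
    assert (Hgain : forall x, x <= m t - width t ->
              gain t x = lam t * Rmin x (m t - x) * (m t - x)).
    { intros x Hx. unfold gain, scale, dist. rewrite Rabs_left by lra.
      now rewrite Ropp_minus_distr. }
    rewrite (RInt_osc_Chasles t theta 0 d r), (RInt_osc_Chasles t theta d (m t - width t) r).
    replace ((K + 2 * K') * (M t * width t)) with
      (K' * (M t * width t) + (K * (M t * width t) + K' * (M t * width t))) by ring.
    eapply Rle_trans; [apply Rabs_triang|]. apply Rplus_le_compat.
    { apply HS; try lra. intros x Hx. rewrite Hgain by lra.
      apply Rle_trans with 1; [|lra]. rewrite <- Hdm.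
      pose proof (Rmin_l x (m t - x)).
      apply Rmult_le_compat; try lra.
      - apply Rmult_le_pos; [lra|]. apply Rmin_glb; lra.
      - apply Rmult_le_compat_l; lra. }
    eapply Rle_trans; [apply Rabs_triang|]. apply Rplus_le_compat.
    2:{ apply HS; try lra. intros x Hx. apply Rle_trans with (1 * 1); [|lra].
        apply Hnear; [lra|]. apply Rabs_le. lra. }
    assert (Hcase : forall x, d <= x <= m t - width t ->
       (1 / 2 <= lam t * m t * x / 2 <= gain t x) \/
       (1 <= gain t x /\ gain t x = lam t * (m t - x) ^ 2)).
    { intros x Hx. rewrite Hgain by lra.
      destruct (Rle_or_lt x (m t / 2)) as [Hx2|Hx2].
      - left. rewrite Rmin_left by lra. split.
        + assert (lam t * m t * d <= lam t * m t * x) by (apply Rmult_le_compat_l; lra).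
          replace (lam t * m t * d) with 1 in H by (rewrite <- Hdm; ring). lra.
        + replace (lam t * m t * x / 2) with (lam t * x * (m t / 2)) by field.
          apply Rmult_le_compat_l; [apply Rmult_le_pos; lra|lra].
      - right. rewrite Rmin_right by lra. split; [|ring].
        rewrite <- Hlw. rewrite Rmult_assoc. apply Rmult_le_compat_l; [lra|].
        apply Rmult_le_compat; lra. }
    apply HL with (h := fun x => 4 / ((lam t * m t) ^ 2 * x ^ 2) + / (lam t * (m t - x) ^ 2))
      (H := minus (- (4 / ((lam t * m t) ^ 2 * (m t - width t))) + / (lam t * (m t - (m t - width t))))
                  (- (4 / ((lam t * m t) ^ 2 * d)) + / (lam t * (m t - d)))).
    + lra.
    + lra.
    + intros x Hx. lra.
    + intros x Hx. destruct (Hcase x Hx); lra.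
    + intros x Hx.
      assert (Hx0 : 0 < x) by lra. assert (Hmx : 0 < m t - x) by lra.
      assert (Ha : 0 < (lam t * m t * x / 2) ^ 2).
      { apply pow_lt. apply Rmult_lt_0_compat; [|lra]. now apply Rmult_lt_0_compat. }
      assert (Hb : 0 < lam t * (m t - x) ^ 2).
      { apply Rmult_lt_0_compat; [lra|]. now apply pow_lt. }
      replace (4 / ((lam t * m t) ^ 2 * x ^ 2)) with (/ ((lam t * m t * x / 2) ^ 2))
        by (field; lra).
      pose proof (Rinv_0_lt_compat _ Ha) as Hia. pose proof (Rinv_0_lt_compat _ Hb) as Hib.
      destruct (Hcase x Hx) as [Hc1|[Hc1 Hc2]].
      * assert (Hsq : (lam t * m t * x / 2) ^ 2 <= gain t x ^ 2) by (apply pow_incr; lra).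
        pose proof (Rmult_le_compat_l _ _ _ (Rlt_le _ _ Hia) Hsq) as H1.
        rewrite Rinv_l in H1 by lra.
        assert (0 <= / (lam t * (m t - x) ^ 2) * gain t x ^ 2)
          by (apply Rmult_le_pos; lra).
        lra.
      * rewrite <- Hc2 in *. rewrite Rmult_plus_distr_r.
        replace (/ gain t x * gain t x ^ 2) with (gain t x) by (field; lra).
        assert (0 <= / (lam t * m t * x / 2) ^ 2 * gain t x ^ 2)
          by (apply Rmult_le_pos; [lra|apply pow_le; lra]).
        lra.
    + apply (is_RInt_derive (V := R_CompleteNormedModule)
        (fun x => - (4 / ((lam t * m t) ^ 2 * x)) + / (lam t * (m t - x))));
        intros x Hx; rewrite Rmin_left, Rmax_right in Hx by lra.
      * auto_derive.
        { repeat split; repeat apply Rmult_integral_contrapositive_currified; lra. }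
        field. repeat split; lra.
      * apply (ex_derive_continuous (K := R_AbsRing) (V := R_NormedModule)
           (fun x => 4 / ((lam t * m t) ^ 2 * x ^ 2) + / (lam t * (m t - x) ^ 2))).
        auto_derive.
        repeat split; repeat apply Rmult_integral_contrapositive_currified; lra.
    + unfold minus, plus, opp; simpl.
      assert (H1 : 0 < 4 / ((lam t * m t) * ((lam t * m t) * 1) * (m t - width t))).
      { apply Rdiv_lt_0_compat; [lra|]. repeat apply Rmult_lt_0_compat; lra. }
      assert (H2 : 0 < / (lam t * (m t - d))).
      { apply Rinv_0_lt_compat. apply Rmult_lt_0_compat; lra. }
      replace (/ (lam t * (m t - (m t - width t)))) with (width t)
        by (rewrite lam_width; field; lra).
      replace (4 / ((lam t * m t) * ((lam t * m t) * 1) * d)) with (4 * d).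
      2:{ unfold d. field. split; lra. }
      lra.
    + rewrite Hgain by lra. rewrite Rmin_left by lra.
      apply Rle_trans with 1; [|lra]. rewrite <- Hdm. apply Rmult_le_compat_l; [|lra].
      apply Rmult_le_pos; lra.
    + left. apply Rle_trans with (1 * 1); [|lra]. apply Hnear; [lra|].
      apply Rabs_le. lra.
Qed.

Lemma oscillatory_bound : exists K, 0 <= K /\ forall t theta,
  Rabs (RInt (osc t theta) 0 1) <= K * (M t * width t).
Proof.
  destruct left_of_crit as [K1 [HK1 H1]]. destruct right_of_crit as [K2 [HK2 H2]].
  exists (K1 + K2); split; [lra|]. intros t theta.
  assert (HMw : 0 < M t * width t) by (apply Rmult_lt_0_compat; [apply M_pos|apply width_pos]).
  pose proof (Rmult_le_pos _ _ HK2 (Rlt_le _ _ HMw)).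
  specialize (H1 t theta).
  destruct (Rlt_or_le (m t + width t) 1) as [Hlt|Hle].
  - rewrite Rmin_right in H1 by lra.
    rewrite (RInt_osc_Chasles t theta 0 (m t + width t) 1).
    eapply Rle_trans; [apply Rabs_triang|]. specialize (H2 t theta Hlt). lra.
  - rewrite Rmin_left in H1 by lra. lra.
Qed.

End Nonstationary.
(** * Relative derivatives and smoothness up to the boundary *)

(** At an interior point of [D] the trace of the neighbourhoods on [D] is the
    neighbourhood filter itself. *)
Lemma is_derive_on_interior {V : NormedModule R_AbsRing} (D : R -> Prop)
  (f : R -> V) (x : R) (l : V) :
  locally x D -> is_derive_on D f x l <-> is_derive f x l.
Proof.
  intros HD. split; intros [Hlin Hdom]; (split; [exact Hlin|]).
  - intros x0 Hx0 eps.
    assert (Hlim : is_filter_lim (within D (locally x)) x0).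
    { intros Q HQ. unfold within. apply filter_imp with (2 := Hx0 Q HQ). auto. }
    generalize (filter_and _ _ HD (Hdom x0 Hlim eps)). apply filter_imp.
    intros y [HDy Hy]. exact (Hy HDy).
  - intros x0 Hx0 eps.
    assert (Hlim : is_filter_lim (locally x) x0).
    { intros Q HQ. generalize (filter_and _ _ HD (Hx0 Q HQ)). apply filter_imp.
      intros y [HDy Hy]. exact (Hy HDy). }
    unfold within. generalize (Hdom x0 Hlim eps). apply filter_imp. auto.
Qed.

Lemma is_derive_Re (f : R -> C) (x : R) (l : C) :
  is_derive (V := C_R_NormedModule) f x l -> is_derive (fun y => Re (f y)) x (Re l).
Proof.
  intros H.
  apply (filterdiff_ext_lin (fun y => Re (f y)) (fun y => fst (scal y l : C_R_NormedModule))).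
  - apply (filterdiff_comp' (V := C_R_NormedModule) f fst); [exact H|].
    apply (filterdiff_linear (U := C_R_NormedModule)), (is_linear_fst (K := R_AbsRing)
       (U := R_NormedModule) (V := R_NormedModule)).
  - intros y. reflexivity.
Qed.

Lemma is_derive_Im (f : R -> C) (x : R) (l : C) :
  is_derive (V := C_R_NormedModule) f x l -> is_derive (fun y => Im (f y)) x (Im l).
Proof.
  intros H.
  apply (filterdiff_ext_lin (fun y => Im (f y)) (fun y => snd (scal y l : C_R_NormedModule))).
  - apply (filterdiff_comp' (V := C_R_NormedModule) f snd); [exact H|].
    apply (filterdiff_linear (U := C_R_NormedModule)), (is_linear_snd (K := R_AbsRing)
       (U := R_NormedModule) (V := R_NormedModule)).
  - intros y. reflexivity.
Qed.

Lemma Derive_on_interior_R (D : R -> Prop) (f : R -> R) (x : R) :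
  locally x D -> ex_derive_on (V := R_NormedModule) D f x ->
  is_derive f x (Derive_on (V := R_CompleteNormedModule) D f x).
Proof.
  intros HD [l Hl].
  apply (is_derive_on_interior (V := R_NormedModule) D f x); [exact HD|].
  apply (iota_correct (V := R_CompleteNormedModule)
           (is_derive_on (V := R_NormedModule) D f x)).
  exists l; split; [exact Hl|]. intros l' Hl'.
  apply (is_derive_on_interior (V := R_NormedModule) D f x) in Hl; [|exact HD].
  apply (is_derive_on_interior (V := R_NormedModule) D f x) in Hl'; [|exact HD].
  rewrite <- (is_derive_unique _ _ _ Hl). exact (is_derive_unique _ _ _ Hl').
Qed.

Lemma Derive_on_interior_C (D : R -> Prop) (f : R -> C) (x : R) :
  locally x D -> ex_derive_on (V := C_R_NormedModule) D f x ->
  is_derive (V := C_R_NormedModule) f x (Derive_on (V := C_R_CompleteNormedModule) D f x).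
Proof.
  intros HD [l Hl].
  apply (is_derive_on_interior (V := C_R_NormedModule) D f x); [exact HD|].
  apply (iota_correct (V := C_R_CompleteNormedModule)
           (is_derive_on (V := C_R_NormedModule) D f x)).
  exists l; split; [exact Hl|]. intros l' Hl'.
  apply (is_derive_on_interior (V := C_R_NormedModule) D f x) in Hl; [|exact HD].
  apply (is_derive_on_interior (V := C_R_NormedModule) D f x) in Hl'; [|exact HD].
  apply injective_projections.
  - change (Re l = Re l').
    rewrite <- (is_derive_unique _ _ _ (is_derive_Re _ _ _ Hl)).
    exact (is_derive_unique _ _ _ (is_derive_Re _ _ _ Hl')).
  - change (Im l = Im l').
    rewrite <- (is_derive_unique _ _ _ (is_derive_Im _ _ _ Hl)).
    exact (is_derive_unique _ _ _ (is_derive_Im _ _ _ Hl')).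
Qed.

Lemma smooth_on2_partial1 {V : CompleteNormedModule R_AbsRing} D1 D2 (f : R -> R -> V) :
  smooth_on2 D1 D2 f -> smooth_on2 D1 D2 (partial1 D1 f).
Proof. intros Hf k. apply (Hf (S k)). Qed.

Lemma smooth_on2_partial2 {V : CompleteNormedModule R_AbsRing} D1 D2 (f : R -> R -> V) :
  smooth_on2 D1 D2 f -> smooth_on2 D1 D2 (partial2 D2 f).
Proof. intros Hf k. apply (Hf (S k)). Qed.

Lemma smooth_on2_iter {V : CompleteNormedModule R_AbsRing} D1 D2 (f : R -> R -> V) k :
  smooth_on2 D1 D2 f -> smooth_on2 D1 D2 (Nat.iter k (partial1 D1) f).
Proof.
  intros Hf. induction k as [|k IH]; [exact Hf|]. now apply smooth_on2_partial1.
Qed.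

(** Composition with this retraction of the line onto [0, 1] turns continuity
    relative to [0, 1] into continuity on the line, and does not affect
    derivatives in the open interval. *)
Definition clamp (x : R) : R := Rmax 0 (Rmin x 1).

Lemma clamp_I01 x : I01 (clamp x).
Proof.
  unfold I01, clamp. split; [apply Rmax_l|].
  apply Rmax_lub; [lra|apply Rmin_r].
Qed.

Lemma clamp_id x : I01 x -> clamp x = x.
Proof.
  intros [H0 H1]. unfold clamp. rewrite Rmin_left by exact H1. now apply Rmax_right.
Qed.

Lemma clamp_lipschitz x y : Rabs (clamp x - clamp y) <= Rabs (x - y).
Proof.
  unfold clamp, Rmax, Rmin.
  repeat destruct Rle_dec; unfold Rabs; repeat destruct Rcase_abs; lra.
Qed.

Lemma locally_I01 x : 0 < x < 1 -> locally x I01.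
Proof.
  intros Hx. apply (locally_interval I01 x 0 1); simpl; try lra.
  intros y Hy0 Hy1. simpl in Hy0, Hy1. unfold I01. lra.
Qed.

Definition square (p : R * R) : Prop := I01 (fst p) /\ I01 (snd p).

Lemma clamp_continuous_2d (f : R -> R -> R) :
  continuous_on square (fun p => f (fst p) (snd p)) ->
  forall x y, continuity_2d_pt (fun u v => f (clamp u) (clamp v)) x y.
Proof.
  intros Hf x y. apply continuity_2d_pt_filterlim.
  set (q := (clamp x, clamp y)).
  apply (filterlim_comp _ _ _ (fun z : R * R => (clamp (fst z), clamp (snd z)))
           (fun p => f (fst p) (snd p)) _ (within square (locally q)) _).
  - intros Q [d Hd]. exists d. intros [u v] [Hu Hv]. simpl in *.
    apply Hd.
    + split; simpl.
      * eapply Rle_lt_trans; [apply clamp_lipschitz|exact Hu].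
      * eapply Rle_lt_trans; [apply clamp_lipschitz|exact Hv].
    + split; apply clamp_I01.
  - apply (Hf q). split; apply clamp_I01.
Qed.

Lemma continuous_slice1 (f : R -> R -> R) y :
  continuous_on square (fun p => f (fst p) (snd p)) -> I01 y ->
  forall x, continuous (fun u => f (clamp u) y) x.
Proof.
  intros Hf Hy x. apply continuity_pt_filterlim.
  intros eps Heps.
  destruct (clamp_continuous_2d f Hf x y (mkposreal _ Heps)) as [d Hd].
  exists d; split; [apply cond_pos|]. intros u [_ Hu]. simpl in *.
  specialize (Hd u y Hu). rewrite !(clamp_id y Hy) in Hd. apply Hd.
  unfold Rminus. rewrite Rplus_opp_r, Rabs_R0. apply cond_pos.
Qed.

Lemma continuous_slice2 (f : R -> R -> R) x :
  continuous_on square (fun p => f (fst p) (snd p)) -> I01 x ->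
  forall y, continuous (fun v => f x (clamp v)) y.
Proof.
  intros Hf Hx y. apply continuity_pt_filterlim.
  intros eps Heps.
  destruct (clamp_continuous_2d f Hf x y (mkposreal _ Heps)) as [d Hd].
  exists d; split; [apply cond_pos|]. intros v [_ Hv]. simpl in *.
  specialize (Hd x v). rewrite !(clamp_id x Hx) in Hd. apply Hd; [|exact Hv].
  unfold Rminus. rewrite Rplus_opp_r, Rabs_R0. apply cond_pos.
Qed.

(** Uniform continuity with tolerance [1]: the segment from the origin to
    [(x, y)] is cut into [n] steps, along each of which [f] varies by less
    than [1]. *)
Lemma bounded_on_square (f : R -> R -> R) :
  continuous_on square (fun p => f (fst p) (snd p)) ->
  exists A, forall x y, I01 x -> I01 y -> Rabs (f x y) <= A.
Proof.
  intros Hf.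
  destruct (uniform_continuity_2d (fun u v => f (clamp u) (clamp v)) 0 1 0 1
    (fun x y _ _ => clamp_continuous_2d f Hf x y) (mkposreal 1 Rlt_0_1)) as [d Hd].
  simpl in Hd.
  destruct (INR_archimed d 1 (cond_pos d)) as [n Hn].
  assert (Hn0 : 0 < INR n).
  { destruct n; [simpl in Hn; lra|apply lt_0_INR; lia]. }
  exists (Rabs (f 0 0) + INR n). intros x y Hx Hy.
  assert (Hstep : forall z i, I01 z -> (i <= n)%nat -> I01 (INR i / INR n * z)).
  { intros z i [Hz0 Hz1] Hi.
    assert (0 <= INR i / INR n <= 1).
    { split; [apply Rmult_le_pos; [apply pos_INR|left; now apply Rinv_0_lt_compat]|].
      apply Rmult_le_reg_r with (INR n); [exact Hn0|].
      unfold Rdiv. rewrite Rmult_assoc, Rinv_l by lra.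
      rewrite Rmult_1_r, Rmult_1_l. now apply le_INR. }
    split; [apply Rmult_le_pos; lra|]. nra. }
  assert (Hclose : forall z i, I01 z -> Rabs (INR (S i) / INR n * z - INR i / INR n * z) < d).
  { intros z i [Hz0 Hz1]. rewrite S_INR.
    replace ((INR i + 1) / INR n * z - INR i / INR n * z) with (z / INR n) by (field; lra).
    rewrite Rabs_pos_eq.
    - apply Rmult_lt_reg_r with (INR n); [exact Hn0|].
      unfold Rdiv. rewrite Rmult_assoc, Rinv_l by lra. lra.
    - apply Rmult_le_pos; [lra|left; now apply Rinv_0_lt_compat]. }
  assert (Hind : forall i, (i <= n)%nat ->
    Rabs (f (INR i / INR n * x) (INR i / INR n * y)) <= Rabs (f 0 0) + INR i).
  { induction i as [|i IH]; intros Hi.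
    - simpl INR. unfold Rdiv. rewrite !Rmult_0_l. lra.
    - assert (Hi' : (i <= n)%nat) by lia.
      pose proof (Hd _ _ _ _ (Hstep x i Hx Hi') (Hstep y i Hy Hi')
        (Hstep x (S i) Hx Hi) (Hstep y (S i) Hy Hi) (Hclose x i Hx) (Hclose y i Hy)) as H.
      rewrite !clamp_id in H by (apply Hstep; assumption).
      specialize (IH Hi').
      pose proof (Rabs_triang_inv (f (INR (S i) / INR n * x) (INR (S i) / INR n * y))
        (f (INR i / INR n * x) (INR i / INR n * y))).
      rewrite (S_INR i) at 3. lra. }
  specialize (Hind n (Nat.le_refl n)).
  replace (INR n / INR n * x) with x in Hind by (field; lra).
  replace (INR n / INR n * y) with y in Hind by (field; lra).
  exact Hind.
Qed.

Lemma smooth_on2_continuous_square (f : R -> R -> R) :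
  smooth_on2 (V := R_CompleteNormedModule) I01 I01 f ->
  continuous_on square (fun p => f (fst p) (snd p)).
Proof. intros Hf. apply (Hf O). Qed.

Lemma is_derive_clamp1 (f : R -> R -> R) x y :
  smooth_on2 (V := R_CompleteNormedModule) I01 I01 f -> 0 < x < 1 -> I01 y ->
  is_derive (fun u => f (clamp u) y) x
    (partial1 (V := R_CompleteNormedModule) I01 f (clamp x) y).
Proof.
  intros Hf Hx Hy. assert (HxI : I01 x) by (unfold I01; lra).
  rewrite (clamp_id x HxI).
  apply (is_derive_ext_loc (fun u => f u y)).
  - generalize (locally_I01 x Hx). apply filter_imp. intros u Hu. now rewrite clamp_id.
  - destruct (Hf 1%nat) as [_ [Hex _]].
    exact (Derive_on_interior_R I01 (fun u => f u y) x (locally_I01 x Hx)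
             (proj1 (Hex x y HxI Hy))).
Qed.

Lemma is_derive_clamp2 (f : R -> R -> R) x y :
  smooth_on2 (V := R_CompleteNormedModule) I01 I01 f -> I01 x -> 0 < y < 1 ->
  is_derive (fun v => f x (clamp v)) y
    (partial2 (V := R_CompleteNormedModule) I01 f x (clamp y)).
Proof.
  intros Hf Hx Hy. assert (HyI : I01 y) by (unfold I01; lra).
  rewrite (clamp_id y HyI).
  apply (is_derive_ext_loc (fun v => f x v)).
  - generalize (locally_I01 y Hy). apply filter_imp. intros u Hu. now rewrite clamp_id.
  - destruct (Hf 1%nat) as [_ [Hex _]].
    exact (Derive_on_interior_R I01 (fun v => f x v) y (locally_I01 y Hy)
             (proj2 (Hex x y Hx HyI))).
Qed.

Lemma mean_value_I01 (F F' : R -> R) a b :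
  I01 a -> I01 b -> (forall x, continuous F x) ->
  (forall x, 0 < x < 1 -> is_derive F x (F' x)) ->
  exists xi, I01 xi /\ F b - F a = F' xi * (b - a).
Proof.
  intros Ha Hb Hc Hd. unfold I01 in *.
  assert (Hmin : 0 <= Rmin a b) by (apply Rmin_glb; lra).
  assert (Hmax : Rmax a b <= 1) by (apply Rmax_lub; lra).
  destruct (MVT_gen F a b F') as [xi [Hxi H]].
  - intros x Hx. apply Hd. lra.
  - intros x _. apply continuity_pt_filterlim, Hc.
  - exists xi; split; [lra|exact H].
Qed.

(** All derivatives vanish on the right of [b], hence at [b] by continuity. *)
Lemma derivatives_vanish_at_support_end (G : nat -> R -> R) (b : R) :
  (forall k x, is_derive (G k) x (G (S k) x)) ->
  (forall x, b < x -> G 0%nat x = 0) -> forall k, G k b = 0.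
Proof.
  intros Hd H0.
  assert (Hright : forall k x, b < x -> G k x = 0).
  { induction k as [|k IH]; intros x Hx; [now apply H0|].
    rewrite <- (is_derive_unique _ _ _ (Hd k x)).
    rewrite (Derive_ext_loc _ (fun _ => 0)); [apply Derive_const|].
    apply (locally_interval _ x b p_infty); simpl; [exact Hx|exact I|].
    intros y Hy _. apply IH, Hy. }
  intros k.
  assert (Hc : continuous (G k) b).
  { apply (ex_derive_continuous (K := R_AbsRing) (V := R_NormedModule)).
    eexists; apply Hd. }
  destruct (Req_dec (G k b) 0) as [Hz|Hz]; [exact Hz|exfalso].
  destruct (proj1 (filterlim_locally _ _) Hc (mkposreal _ (Rabs_pos_lt _ Hz))) as [d Hdd].
  pose proof (cond_pos d) as Hdp.
  assert (Hb : ball b d (b + d / 2)).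
  { change (Rabs (b + d / 2 - b) < d). apply Rabs_def1; lra. }
  specialize (Hdd _ Hb). change (Rabs (G k (b + d / 2) - G k b) < Rabs (G k b)) in Hdd.
  rewrite Hright in Hdd by lra. unfold Rminus in Hdd.
  rewrite Rplus_0_l, Rabs_Ropp in Hdd. lra.
Qed.

(** * The complex integral *)

Lemma Cmod_le_Re_Im (z : C) : Cmod z <= Rabs (Re z) + Rabs (Im z).
Proof.
  destruct z as [x y]. unfold Cmod; simpl.
  pose proof (Rabs_pos x); pose proof (Rabs_pos y).
  rewrite <- (sqrt_Rsqr (Rabs x + Rabs y)) by lra.
  apply sqrt_le_1_alt. unfold Rsqr.
  rewrite !Rmult_1_r.
  assert (Rabs x * Rabs x = x * x) by (rewrite <- Rabs_mult; apply Rabs_pos_eq; nra).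
  assert (Rabs y * Rabs y = y * y) by (rewrite <- Rabs_mult; apply Rabs_pos_eq; nra).
  nra.
Qed.

Lemma Rabs_Re_le (z : C) : Rabs (Re z) <= Cmod z.
Proof. eapply Rle_trans; [apply Rmax_l|apply Rmax_Cmod]. Qed.

Lemma Rabs_Im_le (z : C) : Rabs (Im z) <= Cmod z.
Proof. eapply Rle_trans; [apply Rmax_r|apply Rmax_Cmod]. Qed.

Lemma RInt_gen_supported (f : R -> C) (l : C) :
  (forall x, ~ I01 x -> f x = RtoC 0) ->
  is_RInt (V := C_R_NormedModule) f 0 1 l ->
  RInt_gen (V := C_R_CompleteNormedModule) f (Rbar_locally m_infty) (Rbar_locally p_infty) = l.
Proof.
  intros Hz Hl. apply (is_RInt_gen_unique (V := C_R_CompleteNormedModule)).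
  intros Q HQ.
  assert (Hzero : forall a b, a <= b -> (forall x, a < x < b -> ~ I01 x) ->
            is_RInt (V := C_R_NormedModule) f a b zero).
  { intros a b Hab Hx.
    apply (is_RInt_ext (V := C_R_NormedModule) (fun _ => zero)).
    - intros x Hxx. rewrite Rmin_left, Rmax_right in Hxx by lra.
      rewrite Hz by auto. reflexivity.
    - pose proof (is_RInt_const (V := C_R_NormedModule) a b zero) as H.
      rewrite (scal_zero_r (V := C_R_NormedModule)) in H. exact H. }
  apply (Filter_prod _ _ _ (fun a => a < 0) (fun b => 1 < b)).
  - exists 0. auto.
  - exists 1. auto.
  - intros a b Ha Hb. exists l; split; [|now apply locally_singleton].
    simpl. rewrite <- (plus_zero_l (G := C_R_NormedModule) l).
    apply (is_RInt_Chasles (V := C_R_NormedModule) f a 0 b).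
    + apply Hzero; [lra|]. intros x Hx. unfold I01; lra.
    + rewrite <- (plus_zero_r (G := C_R_NormedModule) l).
      apply (is_RInt_Chasles (V := C_R_NormedModule) f 0 1 b); [exact Hl|].
      apply Hzero; [lra|]. intros x Hx. unfold I01; lra.
Qed.
(** * The weight of the amplitude and the critical point *)

(** This is the inequality of [amplitude_weight_bound] before raising to the
    power [nu].  For [x <= m / 2] and for [x >= 2 * m] the left-hand side is at
    most [4 * l * min (x, |x - m|) * |x - m|]; otherwise
    [l * x ^ 2 <= 2 * l * m * x <= 2 * B * (l * phi * x)]. *)
Lemma quadratic_weight_bound (l m x phi B : R) :
  0 < l -> 0 < x -> 0 <= phi -> 0 <= B -> m <= B * phi ->
  l * x ^ 2 <= (4 + 2 * B) * (1 + l * Rmin x (Rabs (x - m)) * Rabs (x - m))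
                * (1 + l * phi * x).
Proof.
  intros Hl Hx Hphi HB Hm.
  set (Y := l * Rmin x (Rabs (x - m)) * Rabs (x - m)).
  set (Z := l * phi * x).
  assert (HlX : 0 < l * x) by now apply Rmult_lt_0_compat.
  assert (HZ : 0 <= Z) by (unfold Z; apply Rmult_le_pos; [apply Rmult_le_pos|]; lra).
  assert (HY : 0 <= Y).
  { unfold Y. pose proof (Rabs_pos (x - m)).
    apply Rmult_le_pos; [apply Rmult_le_pos; [lra|apply Rmin_glb; lra]|lra]. }
  assert (Hcases : l * x ^ 2 <= 4 * Y \/ l * x ^ 2 <= 2 * (B * Z)).
  { destruct (Rle_or_lt x (m / 2)) as [H1|H1].
    - left. unfold Y. rewrite Rabs_left1 by lra. rewrite Rmin_left by lra.
      replace (l * x ^ 2) with (l * x * x) by ring.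
      assert (l * x * x <= l * x * - (x - m)) by (apply Rmult_le_compat_l; lra).
      assert (0 <= l * x * - (x - m)) by (apply Rmult_le_pos; lra). lra.
    - destruct (Rle_or_lt x (2 * m)) as [H2|H2].
      + right. unfold Z. replace (l * x ^ 2) with (l * x * x) by ring.
        replace (2 * (B * (l * phi * x))) with (l * x * (2 * (B * phi))) by ring.
        apply Rmult_le_compat_l; lra.
      + left. unfold Y.
        assert (H3 : x / 2 <= Rabs (x - m)) by (pose proof (Rle_abs (x - m)); lra).
        assert (H4 : x / 2 <= Rmin x (Rabs (x - m))) by (apply Rmin_glb; lra).
        replace (l * x ^ 2) with (4 * (l * (x / 2) * (x / 2))) by field.
        apply Rmult_le_compat_l; [lra|].
        apply Rmult_le_compat; [apply Rmult_le_pos; lra|lra| |exact H3].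
        apply Rmult_le_compat_l; lra. }
  assert (HBZ : 0 <= B * Z) by now apply Rmult_le_pos.
  assert (HBY : 0 <= B * Y) by now apply Rmult_le_pos.
  assert (HYZ : 0 <= Y * Z) by now apply Rmult_le_pos.
  assert (HBYZ : 0 <= B * (Y * Z)) by now apply Rmult_le_pos.
  replace ((4 + 2 * B) * (1 + Y) * (1 + Z)) with
    (4 + 4 * Y + 4 * Z + 4 * (Y * Z) + 2 * B + 2 * (B * Y) + 2 * (B * Z) + 2 * (B * (Y * Z)))
    by ring.
  destruct Hcases; lra.
Qed.

Lemma amplitude_weight_bound (nu l m x phi B : R) (n : nat) :
  0 <= nu <= INR n -> 0 < l -> 0 < x -> 0 <= phi -> 0 <= B -> m <= B * phi ->
  Rpower x (2 * nu) * Rpower (1 + l * phi * x) (- nu)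
    <= Rpower (4 + 2 * B) nu *
       (Rpower l (- nu) * (1 + l * Rmin x (Rabs (x - m)) * Rabs (x - m)) ^ n).
Proof.
  intros Hnu Hl Hx Hphi HB Hm.
  pose proof (quadratic_weight_bound l m x phi B Hl Hx Hphi HB Hm) as H.
  set (Y := l * Rmin x (Rabs (x - m)) * Rabs (x - m)) in *.
  assert (HZ : 0 <= l * phi * x) by (apply Rmult_le_pos; [apply Rmult_le_pos|]; lra).
  assert (HY : 0 <= Y).
  { unfold Y. pose proof (Rabs_pos (x - m)).
    apply Rmult_le_pos; [apply Rmult_le_pos; [lra|apply Rmin_glb; lra]|lra]. }
  set (Z := l * phi * x) in *.
  assert (Hx2 : 0 < x ^ 2) by now apply pow_lt.
  assert (Hpow : Rpower l nu * Rpower x (2 * nu)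
                 <= Rpower (4 + 2 * B) nu * Rpower (1 + Y) nu * Rpower (1 + Z) nu).
  { rewrite <- Rpower_mult. replace (Rpower x 2) with (x ^ 2)
      by (rewrite <- (Rpower_pow 2 x Hx); f_equal; simpl; ring).
    rewrite Rpower_mult_distr by assumption.
    rewrite !Rpower_mult_distr by (try apply Rmult_lt_0_compat; lra).
    apply Rle_Rpower_l; [lra|]. split; [now apply Rmult_lt_0_compat|exact H]. }
  assert (HYn : Rpower (1 + Y) nu <= (1 + Y) ^ n).
  { rewrite <- Rpower_pow by lra. apply Rle_Rpower; lra. }
  assert (HlP : 0 < Rpower l nu) by apply exp_pos.
  assert (HZP : 0 < Rpower (1 + Z) nu) by apply exp_pos.
  assert (HAP : 0 < Rpower (4 + 2 * B) nu) by apply exp_pos.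
  rewrite !Rpower_Ropp.
  apply Rmult_le_reg_l with (Rpower l nu); [exact HlP|].
  apply Rmult_le_reg_r with (Rpower (1 + Z) nu); [exact HZP|].
  replace (Rpower l nu * (Rpower x (2 * nu) * / Rpower (1 + Z) nu) * Rpower (1 + Z) nu)
    with (Rpower l nu * Rpower x (2 * nu)) by (field; lra).
  replace (Rpower l nu * (Rpower (4 + 2 * B) nu * (/ Rpower l nu * (1 + Y) ^ n))
             * Rpower (1 + Z) nu)
    with (Rpower (4 + 2 * B) nu * (1 + Y) ^ n * Rpower (1 + Z) nu) by (field; lra).
  eapply Rle_trans; [exact Hpow|].
  apply Rmult_le_compat_r; [lra|]. apply Rmult_le_compat_l; lra.
Qed.

(** The lower bound on the derivative at [mu = 0] gives
    [c * mu0 phi <= |S_mu(0, phi)|], and [S_mu(0, .)] is Lipschitz and vanishes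
    at [0]. *)
Lemma critical_point_linear_bound (S : R -> R -> R) (mu0 : R -> R) (c : R) :
  smooth_on2 (V := R_CompleteNormedModule) I01 I01 S -> 0 < c ->
  (forall mu phi, I01 mu -> I01 phi ->
     c * Rabs (mu - mu0 phi) <= Rabs (partial1 (V := R_CompleteNormedModule) I01 S mu phi)) ->
  (forall phi, I01 phi -> 0 <= mu0 phi) ->
  partial1 (V := R_CompleteNormedModule) I01 S 0 0 = 0 ->
  exists B, 0 <= B /\ forall phi, I01 phi -> mu0 phi <= B * phi.
Proof.
  intros HS Hc Hlow Hm Hz.
  pose proof (smooth_on2_partial1 _ _ _ HS) as HS1.
  set (S1 := partial1 (V := R_CompleteNormedModule) I01 S) in *.
  destruct (bounded_on_square _ (smooth_on2_continuous_square _
              (smooth_on2_partial2 _ _ _ HS1))) as [A HA].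
  assert (HA0 : 0 <= A).
  { eapply Rle_trans; [apply Rabs_pos|apply (HA 0 0); unfold I01; lra]. }
  exists (A / c). split; [apply Rmult_le_pos; [lra|left; now apply Rinv_0_lt_compat]|].
  intros phi Hphi.
  assert (H0 : I01 0) by (unfold I01; lra).
  destruct (mean_value_I01 (fun v => S1 0 (clamp v))
    (fun v => partial2 (V := R_CompleteNormedModule) I01 S1 0 (clamp v)) 0 phi H0 Hphi)
    as [xi [Hxi Hmv]].
  - intros y. apply continuous_slice2; [now apply smooth_on2_continuous_square|exact H0].
  - intros y Hy. now apply is_derive_clamp2.
  - rewrite (clamp_id 0 H0), (clamp_id phi Hphi), Hz, !Rminus_0_r in Hmv.
    specialize (Hlow 0 phi H0 Hphi). rewrite Hmv, Rabs_mult in Hlow.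
    specialize (HA 0 (clamp xi) H0 (clamp_I01 xi)).
    rewrite (Rabs_pos_eq phi) in Hlow by apply Hphi.
    rewrite Rminus_0_l, Rabs_Ropp, Rabs_pos_eq in Hlow by auto.
    apply Rmult_le_reg_l with c; [exact Hc|].
    replace (c * (A / c * phi)) with (A * phi) by (field; lra).
    eapply Rle_trans; [exact Hlow|]. apply Rmult_le_compat_r; [apply Hphi|exact HA].
Qed.

(** * The estimate *)

Theorem proposition2p4
  (nu c C0 lambda0 : R)
  (Hnu : 0 <= nu) (Hc : 0 < c) (HC0 : 0 < C0) (Hlambda0 : 1 <= lambda0)
  (S : R -> R -> R) (HS : smooth_on2 (V := R_CompleteNormedModule) I01 I01 S)
  (gamma : R -> R -> R -> C)
  (Hgamma : forall lambda, lambda0 <= lambda ->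
     smooth_on2 (V := C_R_CompleteNormedModule) whole I01
       (fun mu phi => gamma mu lambda phi))
  (Hsupp : forall lambda phi, lambda0 <= lambda -> I01 phi ->
     included (support (fun mu => gamma mu lambda phi)) I01)
  (Calpha : nat -> R)
  (Hbound : forall (alpha : nat) (mu lambda phi : R),
     0 < mu <= 1 -> lambda0 <= lambda -> I01 phi ->
     Cmod (Nat.iter alpha (partial1 (V := C_R_CompleteNormedModule) whole)
             (fun mu' phi' => gamma mu' lambda phi') mu phi)
     <= Calpha alpha * Rpower mu (2 * nu - INR alpha)
        * Rpower (1 + lambda * phi * mu) (- nu))
  (HS2 : forall mu phi, I01 mu -> I01 phi ->
     c <= Rabs (partial1 (V := R_CompleteNormedModule) I01
                  (partial1 (V := R_CompleteNormedModule) I01 S) mu phi))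
  (HSmixed : forall mu phi, I01 mu -> I01 phi ->
     C0 <= Rabs (partial1 (V := R_CompleteNormedModule) I01
                   (partial2 (V := R_CompleteNormedModule) I01 S) mu phi))
  (mu0 : R -> R)
  (Hcrit : forall phi, I01 phi ->
     unique (fun mu => I01 mu /\
               partial1 (V := R_CompleteNormedModule) I01 S mu phi = 0)
            (mu0 phi))
  (Hmu0_smooth : smooth_on (V := R_CompleteNormedModule) I01 mu0)
  (Hmu0_0 : mu0 0 = 0) :
  exists C' : R, 0 < C' /\
    forall lambda phi, lambda0 <= lambda -> I01 phi ->
      Cmod (osc_integral S gamma lambda phi) <= C' * Rpower lambda (- nu - 1 / 2).
Proof.
  set (T := {p : R * R | lambda0 <= fst p /\ I01 (snd p)}).
  set (lam := fun t : T => fst (proj1_sig t)).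
  set (ph := fun t : T => snd (proj1_sig t)).
  assert (Hlam : forall t, lambda0 <= lam t) by (intros [p Hp]; apply Hp).
  assert (Hph : forall t, I01 (ph t)) by (intros [p Hp]; apply Hp).
  assert (Hlam1 : forall t, 1 <= lam t) by (intros t; specialize (Hlam t); lra).
  assert (Hmu : forall phi, I01 phi -> I01 (mu0 phi)) by (intros phi Hphi; apply (Hcrit phi Hphi)).
  set (dS := fun k => Nat.iter k (partial1 (V := R_CompleteNormedModule) I01) S).
  assert (HdS : forall k, smooth_on2 (V := R_CompleteNormedModule) I01 I01 (dS k)).
  { intros k. now apply smooth_on2_iter. }
  set (P := fun k (t : T) x => dS k (clamp x) (ph t)).
  assert (Hlow : forall mu phi, I01 mu -> I01 phi ->
     c * Rabs (mu - mu0 phi) <= Rabs (dS 1%nat mu phi)).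
  { intros mu phi Hm Hphi.
    destruct (mean_value_I01 (fun u => dS 1%nat (clamp u) phi)
       (fun u => dS 2%nat (clamp u) phi) (mu0 phi) mu (Hmu phi Hphi) Hm) as [xi [Hxi Hmv]].
    - intros x. apply continuous_slice1; [now apply smooth_on2_continuous_square|exact Hphi].
    - intros x Hx. now apply (is_derive_clamp1 (dS 1%nat)).
    - rewrite (clamp_id mu Hm), (clamp_id _ (Hmu phi Hphi)), (clamp_id xi Hxi) in Hmv.
      assert (Hz : dS 1%nat (mu0 phi) phi = 0) by apply (Hcrit phi Hphi).
      rewrite Hz, Rminus_0_r in Hmv. rewrite Hmv, Rabs_mult.
      apply Rmult_le_compat_r; [apply Rabs_pos|]. now apply HS2. }
  destruct (critical_point_linear_bound S mu0 c HS Hc Hlow) as [B [HB HmB]].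
  { intros phi Hphi. apply (Hmu phi Hphi). }
  { assert (H0 : I01 0) by (unfold I01; lra).
    rewrite <- Hmu0_0 at 1. apply (Hcrit 0 H0). }
  destruct (nfloor_ex nu Hnu) as [n' Hn'].
  (* Any integer above [nu] will do as the exponent of [1 + gain]. *)
  set (n := Datatypes.S n').
  assert (Hn : 0 <= nu <= INR n) by (unfold n; rewrite S_INR; lra).
  set (Gam := fun k (t : T) x =>
    Nat.iter k (partial1 (V := C_R_CompleteNormedModule) whole)
      (fun mu' phi' => gamma mu' (lam t) phi') x (ph t)).
  assert (Hwhole : forall x, locally x whole) by (intros x; exists posreal_one; easy).
  assert (HGam : forall k t x, is_derive (V := C_R_NormedModule) (Gam k t) x (Gam (Datatypes.S k) t x)).
  { intros k t x.
    destruct (smooth_on2_iter _ _ _ k (Hgamma (lam t) (Hlam t)) 1%nat) as [_ [Hex _]].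
    exact (Derive_on_interior_C whole (Gam k t) x (Hwhole x) (proj1 (Hex x (ph t) I (Hph t)))). }
  assert (Hout : forall lambda phi x, lambda0 <= lambda -> I01 phi -> ~ I01 x ->
            gamma x lambda phi = RtoC 0).
  { intros lambda phi x Hl Hphi Hx.
    destruct (Ceq_dec (gamma x lambda phi) (RtoC 0)) as [H|H]; [exact H|].
    exfalso. apply Hx. apply (Hsupp lambda phi Hl Hphi).
    intros V [d Hd]. exists x. split; [|exact H]. apply Hd.
    unfold disc. rewrite Rminus_diag, Rabs_R0. apply cond_pos. }
  (* [part] is the real or the imaginary part. *)
  assert (Hreal : forall part : C -> R,
    (forall z, Rabs (part z) <= Cmod z) -> part (RtoC 0) = 0 ->
    (forall (f : R -> C) x l, is_derive (V := C_R_NormedModule) f x l ->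
       is_derive (fun y => part (f y)) x (part l)) ->
    exists K, 0 <= K /\ forall t theta,
      ex_RInt (fun x => cos (lam t * P 0%nat t x + theta) * part (Gam 0%nat t x)) 0 1 /\
      Rabs (RInt (fun x => cos (lam t * P 0%nat t x + theta) * part (Gam 0%nat t x)) 0 1)
        <= K * (Rpower (lam t) (- nu) * / sqrt (lam t))).
  { intros part Hle Hz Hd.
    assert (HPc : forall t x, continuous (P 0%nat t) x).
    { intros t x. apply continuous_slice1; [now apply smooth_on2_continuous_square|apply Hph]. }
    destruct (oscillatory_bound T lam (fun t => mu0 (ph t)) P c Hlam1
       (fun t => Hmu _ (Hph t)) Hc) with (G := fun k t x => part (Gam k t x))
       (M := fun t => Rpower (lam t) (- nu)) (n0 := n) as [K [HK HKb]].
    - intros k t x Hx. now apply (is_derive_clamp1 (dS k)).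
    - intros k.
      destruct (bounded_on_square _ (smooth_on2_continuous_square _ (HdS k))) as [A HA].
      exists A. intros t x _. apply HA; [apply clamp_I01|apply Hph].
    - intros t x Hx. unfold P. assert (HxI : I01 x) by (unfold I01; lra).
      rewrite (clamp_id x HxI). now apply Hlow.
    - exact HPc.
    - intros k t x. apply Hd, HGam.
    - intros k t. apply (derivatives_vanish_at_support_end (fun k x => part (Gam k t x)) 1).
      + intros j x. apply Hd, HGam.
      + intros x Hx. unfold Gam. simpl. rewrite Hout; [exact Hz|apply Hlam|apply Hph|].
        unfold I01. lra.
    - intros t. apply exp_pos.
    - intros k. exists (Rabs (Calpha k) * Rpower (4 + 2 * B) nu). intros t x Hx.
      eapply Rle_trans.
      { apply Rmult_le_compat_r; [apply pow_le; lra|]. eapply Rle_trans; [apply Hle|].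
        apply Hbound; [lra|apply Hlam|apply Hph]. }
      assert (Hpx : Rpower x (2 * nu - INR k) * x ^ k = Rpower x (2 * nu)).
      { rewrite <- Rpower_pow by lra. rewrite <- Rpower_plus. f_equal. ring. }
      replace (Calpha k * Rpower x (2 * nu - INR k) * Rpower (1 + lam t * ph t * x) (- nu) * x ^ k)
        with (Calpha k * (Rpower x (2 * nu) * Rpower (1 + lam t * ph t * x) (- nu)))
        by (rewrite <- Hpx; ring).
      rewrite (Rmult_assoc (Rabs (Calpha k))).
      apply Rle_trans with
        (Rabs (Calpha k) * (Rpower x (2 * nu) * Rpower (1 + lam t * ph t * x) (- nu))).
      + apply Rmult_le_compat_r; [|apply Rle_abs].
        apply Rmult_le_pos; left; apply exp_pos.
      + apply Rmult_le_compat_l; [apply Rabs_pos|].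
        unfold gain, scale, dist.
        apply amplitude_weight_bound; try assumption; try apply Hph.
        * specialize (Hlam1 t). lra.
        * lra.
        * apply HmB, Hph.
    - exists K; split; [exact HK|]. intros t theta. split.
      + apply (ex_RInt_osc T lam P (fun k t x => part (Gam k t x)) HPc).
        intros k s x. apply Hd, HGam.
      + apply HKb. }
  destruct (Hreal Re Rabs_Re_le eq_refl is_derive_Re) as [K1 [HK1 HRe]].
  destruct (Hreal Im Rabs_Im_le eq_refl is_derive_Im) as [K2 [HK2 HIm]].
  exists (2 * K1 + 2 * K2 + 1). split; [lra|].
  intros lambda phi Hl Hphi.
  (* Phase [0] gives the cosine and phase [- PI / 2] the sine. *)
  set (t := exist (fun p => lambda0 <= fst p /\ I01 (snd p)) (lambda, phi) (conj Hl Hphi) : T).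
  destruct (HRe t 0) as [E1 B1]. destruct (HRe t (- (PI / 2))) as [E2 B2].
  destruct (HIm t 0) as [E3 B3]. destruct (HIm t (- (PI / 2))) as [E4 B4].
  set (J1 := RInt (fun x => cos (lam t * P 0%nat t x + 0) * Re (Gam 0%nat t x)) 0 1) in *.
  set (J2 := RInt (fun x => cos (lam t * P 0%nat t x + - (PI / 2)) * Re (Gam 0%nat t x)) 0 1) in *.
  set (J3 := RInt (fun x => cos (lam t * P 0%nat t x + 0) * Im (Gam 0%nat t x)) 0 1) in *.
  set (J4 := RInt (fun x => cos (lam t * P 0%nat t x + - (PI / 2)) * Im (Gam 0%nat t x)) 0 1) in *.
  assert (HI : osc_integral S gamma lambda phi = (J1 - J4, J3 + J2)).
  { apply RInt_gen_supported.
    - intros x Hx. rewrite Hout by assumption. apply Cmult_0_r.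
    - assert (Hphase : forall x, 0 < x < 1 -> P 0%nat t x = S x phi).
      { intros x Hx. unfold P. simpl. rewrite clamp_id; [reflexivity|unfold I01; lra]. }
      apply (is_RInt_fct_extend_pair (U := R_NormedModule) (V := R_NormedModule)).
      + apply (is_RInt_ext (V := R_NormedModule) (fun x =>
          minus (cos (lam t * P 0%nat t x + 0) * Re (Gam 0%nat t x))
                (cos (lam t * P 0%nat t x + - (PI / 2)) * Im (Gam 0%nat t x)))).
        * intros x Hx. rewrite Rmin_left, Rmax_right in Hx by lra.
          rewrite (Hphase x Hx). rewrite Rplus_0_r.
          change (lam t * S x phi + - (PI / 2)) with (lam t * S x phi - PI / 2).
          rewrite <- sin_cos_shift. reflexivity.
        * apply (is_RInt_minus (V := R_NormedModule));
            apply (RInt_correct (V := R_CompleteNormedModule)); assumption.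
      + apply (is_RInt_ext (V := R_NormedModule) (fun x =>
          plus (cos (lam t * P 0%nat t x + 0) * Im (Gam 0%nat t x))
                (cos (lam t * P 0%nat t x + - (PI / 2)) * Re (Gam 0%nat t x)))).
        * intros x Hx. rewrite Rmin_left, Rmax_right in Hx by lra.
          rewrite (Hphase x Hx). rewrite Rplus_0_r.
          change (lam t * S x phi + - (PI / 2)) with (lam t * S x phi - PI / 2).
          rewrite <- sin_cos_shift. reflexivity.
        * apply (is_RInt_plus (V := R_NormedModule));
            apply (RInt_correct (V := R_CompleteNormedModule)); assumption. }
  rewrite HI. eapply Rle_trans; [apply Cmod_le_Re_Im|]. simpl.
  assert (Hpow : Rpower lambda (- nu - 1 / 2) = Rpower (lam t) (- nu) * / sqrt (lam t)).
  { change (lam t) with lambda. rewrite <- Rpower_sqrt by lra.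
    rewrite <- Rpower_Ropp, <- Rpower_plus. f_equal. field. }
  rewrite Hpow.
  assert (Hpos : 0 < Rpower (lam t) (- nu) * / sqrt (lam t)) by (rewrite <- Hpow; apply exp_pos).
  set (E := Rpower (lam t) (- nu) * / sqrt (lam t)) in *.
  assert (Rabs (J1 - J4) <= Rabs J1 + Rabs J4)
    by (unfold Rminus; eapply Rle_trans; [apply Rabs_triang|rewrite Rabs_Ropp; lra]).
  assert (Rabs (J3 + J2) <= Rabs J3 + Rabs J2) by apply Rabs_triang.
  lra.
Qed.
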